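(* Let $\varphi\in A_\infty[0,1)$ be a Musielak–Orlicz function on $[0,1)$ of uniformly lower type $p_\varphi^-$ and uniformly upper type $p_\varphi^+$ with $q(\varphi)<p_\varphi^-\le p_\varphi^+<\infty$. Then there is $C>0$ such that for all $f\in L^\varphi[0,1)\cap L^1[0,1)$, $$\sup_{n\in\mathbb N}\|s_nf\|_{L^\varphi[0,1)}\le C\|f\|_{L^\varphi[0,1)}.$$
   Context: Take $\Omega=[0,1)$ with Lebesgue measure $\mathbb P$, and $\mathcal F_n$ the $\sigma$-algebra generated by the dyadic intervals $[k2^{-n},(k+1)2^{-n})$, $0\le k<2^n$; $\mathbb E_n$ the conditional expectations. A Musielak–Orlicz function is $\varphi:[0,1)\times[0,\infty)\to[0,\infty)$ with $\varphi(x,\cdot)$ nondecreasing, $\varphi(x,0)=0$, $\lim_{t\to\infty}\varphi(x,t)=\infty$, $\varphi(\cdot,t)$ measurable, positive, integrable; $\|g\|_{L^\varphi}:=\inf\{\lambda>0:\int_0^1\varphi(x,|g|/\lambda)dx\le1\}$. Uniformly lower (upper) type $p$: $\varphi(x,st)\le Cs^p\varphi(x,t)$ for $s\in(0,1)$ (resp. $s\ge1$). $\varphi\in A_q[0,1)$ ($q>1$): $\sup_{t>0}\mathbb E_n(\varphi(\cdot,t))[\mathbb E_n(\varphi(\cdot,t)^{-1/(q-1)})]^{q-1}\le K$ a.e. for all $n$; $A_1$: $\sup_t\mathbb E_n(\varphi(\cdot,t))/\varphi(\cdot,t)\le K$; $A_\infty=\bigcup_{q\ge1}A_q$; $q(\varphi)=\inf\{q\ge1:\varphi\in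 A_q\}$. Rademacher functions: $r(x)=1$ on $[0,1/2)$, $-1$ on $[1/2,1)$ (extended 1-periodically), $r_n(x)=r(2^nx)$. Walsh functions: $w_n=\prod_{k\ge0}r_k^{n_k}$ where $n=\sum_kn_k2^k$, $n_k\in\{0,1\}$. $\widehat f(n)=\int_0^1fw_n$, and $s_nf:=\sum_{k=0}^{n-1}\widehat f(k)w_k$. *)

(* Defs.v *)
From HB Require Import structures.
From mathcomp Require Import all_boot all_order all_algebra.
From mathcomp Require Import all_classical all_reals all_analysis.
Set Implicit Arguments. Unset Strict Implicit. Unset Printing Implicit Defensive.
Import Order.TTheory GRing.Theory Num.Theory.
Import numFieldNormedType.Exports.
Local Open Scope classical_set_scope.
Local Open Scope ring_scope.

Section Defs.
Variable R : realType.
Local Notation mu := (@lebesgue_measure R).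

Definition I01 : set R := `[0%R, 1%R[.

Definition dyadic_atom (n : nat) (x : R) : set R :=
  let k : R := (Num.floor ((2 ^+ n) * x))%:~R in
  `[k / 2 ^+ n, (k + 1) / 2 ^+ n[.

(* E_n g (x): conditional expectation w.r.t. F_n, i.e. the average of g
   over the dyadic atom of generation n containing x (real-valued version,
   used for integrable g). *)
Definition condexp (n : nat) (g : R -> R) (x : R) : R :=
  (2 ^+ n) * Rintegral mu (dyadic_atom n x) g.

Definition MO_function (phi : R -> R -> R) : Prop :=
  [/\ (forall x s t, I01 x -> 0 <= s -> s <= t -> phi x s <= phi x t),
      (forall x, I01 x -> phi x 0 = 0),
      (forall x, I01 x -> phi x t @[t --> +oo] --> +oo) &
      [/\ (forall t, 0 <= t -> measurable_fun I01 (fun x => phi x t)),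
       (forall t, 0 < t -> forall x, I01 x -> 0 < phi x t) &
       (forall t, 0 <= t -> mu.-integrable I01 (fun x => (phi x t)%:E))]].

(* Luxemburg (quasi-)norm, with value +oo if no admissible lambda exists *)
Definition Lphi_norm (phi : R -> R -> R) (g : R -> R) : \bar R :=
  ereal_inf (EFin @` [set l : R | 0 < l /\
     (\int[mu]_(x in I01) (phi x (`|g x| / l))%:E <= 1)%E]).

Definition in_Lphi (phi : R -> R -> R) (g : R -> R) : Prop :=
  measurable_fun I01 g /\
  exists l : R, 0 < l /\ (\int[mu]_(x in I01) (phi x (`|g x| / l))%:E <= 1)%E.

Definition in_L1 (g : R -> R) : Prop := mu.-integrable I01 (EFin \o g).

Definition unif_lower_type (phi : R -> R -> R) (p : R) : Prop :=
  exists C : R, 0 < C /\ forall x s t, I01 x -> 0 < s < 1 -> 0 <= t ->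
    phi x (s * t) <= C * (s `^ p) * phi x t.

Definition unif_upper_type (phi : R -> R -> R) (p : R) : Prop :=
  exists C : R, 0 < C /\ forall x s t, I01 x -> 1 <= s -> 0 <= t ->
    phi x (s * t) <= C * (s `^ p) * phi x t.

Definition A1 (phi : R -> R -> R) : Prop :=
  exists K : R, {ae mu, forall x, I01 x -> forall (n : nat) (t : R), 0 < t ->
    condexp n (fun y => phi y t) x <= K * phi x t}.

(* dyadic A_q condition, q > 1 (the second average is required to be finite,
   as it must be for the product to be bounded, since E_n(phi) > 0) *)
Definition Aq (phi : R -> R -> R) (q : R) : Prop :=
  exists K : R, {ae mu, forall x, I01 x -> forall (n : nat) (t : R), 0 < t ->
    mu.-integrable (dyadic_atom n x)
        (fun y => ((phi y t) `^ (- (q - 1)^-1))%:E) /\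
    condexp n (fun y => phi y t) x *
      (condexp n (fun y => (phi y t) `^ (- (q - 1)^-1)) x) `^ (q - 1) <= K}.

Definition A_cond (phi : R -> R -> R) (q : R) : Prop :=
  if q == 1 then A1 phi else Aq phi q.

Definition A_infty (phi : R -> R -> R) : Prop :=
  exists q : R, 1 <= q /\ A_cond phi q.

Definition q_index (phi : R -> R -> R) : R :=
  inf [set q : R | 1 <= q /\ A_cond phi q].

Definition frac_part (x : R) : R := x - (Num.floor x)%:~R.
Definition rademacher (x : R) : R := if frac_part x < 2^-1 then 1 else -1.
Definition rad (n : nat) (x : R) : R := rademacher ((2 ^+ n) * x).

(* w_n = prod_k r_k^{n_k}, n = sum_k n_k 2^k; bits n_k vanish for k >= n *)
Definition walsh (n : nat) (x : R) : R :=
  \prod_(k < n) (if odd (n %/ 2 ^ k) then rad k x else 1).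

Definition walsh_coef (f : R -> R) (n : nat) : R :=
  Rintegral mu I01 (fun y => f y * walsh n y).

Definition walsh_partial_sum (n : nat) (f : R -> R) (x : R) : R :=
  \sum_(k < n) walsh_coef f k * walsh k x.

End Defs.

(* Main.v *)
From Pilot Require Import Defs.
From HB Require Import structures.
From mathcomp Require Import all_boot all_order all_algebra.
From mathcomp Require Import all_classical all_reals all_analysis.
From mathcomp Require Import measurable_realfun.
From mathcomp Require Import zify ring lra.
Import Order.TTheory GRing.Theory Num.Theory.
Import numFieldNormedType.Exports.
Local Open Scope classical_set_scope.
Local Open Scope ring_scope.
Set Implicit Arguments. Unset Strict Implicit. Unset Printing Implicit Defensive.

(* Up to the unimodular factor w_n, s_n f is the martingale transform of
   g = f w_n whose coefficients are the binary digits of n: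
     s_n f = w_n * sum_j n_j (E_(j+1) g - E_j g).
   Only finitely many generations matter, so both sides live on a finite binary
   tree whose leaves carry averages of g, |g|, phi(., t) and of the dual weights
   phi(., t)^(-1/(q-1)).  On the tree a good-lambda inequality, uniform in t,
   compares the transform with the dyadic maximal function of |g|: since the
   upper type only gives phi(x, L t) <= C L^(p+) phi(x, t), one iterates the
   exit estimate m times, so that the gain rho^m beats the loss L^(p+), where
   L = 5(m+1)/4.  Summing over the levels t_0 L^j gives the modular inequality;
   the maximal function is handled by A_q and the strict inequality q < p-.
   The passage from the leaves back to f is the same A_q argument, and the norm
   inequality follows from the modular one by the lower type. *)

(** * Scalar inequalities *)

(** The duality between phi(., t) and its dual weight s is used only through the test 1 <= a * s +
    a^(1-q) * phi, valid for every a > 0. The test is linear in both weights, so it survives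
    averaging over an atom, over a tree, or over a selected set of paths; choosing [a] at the end
    brings in the A_q constant. Hence one lemma, [Aq_test], serves three times: it turns a Lebesgue
    bound for the exit set into a bound for the weights, it gives the weak type of the maximal
    function, and it compares phi at an averaged argument with the average of phi.

    The obstacle is that the weight changes with the level. Each level has its own A_q weight, all
    with the same [K], and every estimate is made at one level at a time; only the growth in [t]
    links neighbouring levels. The transform itself is controlled in Lebesgue measure alone, by
    orthogonality of its increments, where coefficients bounded by 1 suffice. On a finite tree,
    stopping times are structural recursions and raise no measurability question. *)

Section Scalar.
Variable R : realType.
Implicit Types (q K S W E a x h s t l r p C e : R).

Lemma powR_oppV x r : 0 < x -> x `^ (- r) = (x^-1) `^ r.
Proof. by move=> x0; rewrite -(powR_inv1 (ltW x0)) -powRrM mulN1r. Qed.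

(* Choosing [l = a / (2 * S)] replaces Hoelder's inequality. *)
Lemma Aq_test q K S W E a : 1 < q -> 0 <= S -> 0 <= W -> 0 <= E ->
  W * S `^ (q - 1) <= K -> 0 < a ->
  (forall l, 0 < l -> a <= l * S + l `^ (1 - q) * E) ->
  a `^ q * W <= 2 `^ q * K * E.
Proof.
move=> q1 S0 W0 E0 WSK a0 H.
have q10 : 0 < q - 1 by lra.
have EE : 1 - q = - (q - 1) by lra.
have [S0'|Sn0] := eqVneq S 0.
  (* With [S = 0], this [l] turns the test into a <= a * E / (E + 1), which is absurd. *)
  have E1 : 0 < (E + 1) / a by rewrite divr_gt0//; lra.
  have := H (((E + 1) / a) `^ (q - 1)^-1) (powR_gt0 _ E1).
  rewrite S0' mulr0 add0r EE -powRrM mulrN mulVf ?gt_eqF// (powR_inv1 (ltW E1)).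
  rewrite invf_div mulrAC ler_pdivlMr; last lra.
  by move=> ?; exfalso; nra.
have Sp : 0 < S by rewrite lt_neqAle eq_sym Sn0.
have l0 : 0 < a / (2 * S) by rewrite divr_gt0//; lra.
have := H _ l0.
have -> : a / (2 * S) * S = a / 2 by field.
rewrite EE powR_oppV// invf_div => H1.
have H2 : a <= 2 * ((2 * S) / a) `^ (q - 1) * E by lra.
have pq x : 0 < x -> x `^ q = x * x `^ (q - 1).
  move=> x0; rewrite -{2}(powRr1 (ltW x0)) -powRD; first by congr (_ `^ _); lra.
  by apply/implyP => _; rewrite gt_eqF.
have H3 : a `^ q <= 2 `^ q * S `^ (q - 1) * E.
  have -> : 2 `^ q * S `^ (q - 1) * E =
     a `^ (q - 1) * (2 * ((2 * S) / a) `^ (q - 1) * E).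
    rewrite pq// -powR_inv1 ?ltW// powRM ?powR_ge0//; last lra.
    rewrite powRM ?ltW// -powRrM mulN1r powRN.
    field. by rewrite gt_eqF// powR_gt0.
  by rewrite pq// mulrC ler_wpM2l// powR_ge0.
apply: (@le_trans _ _ (2 `^ q * S `^ (q - 1) * E * W)); first exact: ler_wpM2r.
have -> : 2 `^ q * S `^ (q - 1) * E * W = (2 `^ q * E) * (W * S `^ (q - 1)) by ring.
have -> : 2 `^ q * K * E = (2 `^ q * E) * K by ring.
by rewrite ler_wpM2l// mulr_ge0// powR_ge0.
Qed.

(** The first term is at least 1 when a^(q-1) >= v, the second one otherwise. *)
Lemma dual_weight_test q v a : 1 < q -> 0 < v -> 0 < a ->
  1 <= a * v `^ (- (q - 1)^-1) + a `^ (1 - q) * v.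
Proof.
move=> q1 v0 a0; have q0 : 0 < q - 1 by lra.
have A0 : 0 <= a * v `^ (- (q - 1)^-1) by rewrite mulr_ge0 ?powR_ge0// ltW.
have B0 : 0 <= a `^ (1 - q) * v by rewrite mulr_ge0 ?powR_ge0// ltW.
have [H|H] := leP 1 (a * v `^ (- (q - 1)^-1)); first lra.
have vp : 0 < v `^ (q - 1)^-1 by rewrite powR_gt0.
have av : a <= v `^ (q - 1)^-1.
  by move: H; rewrite powRN ltr_pdivrMr// mul1r => /ltW.
have H2 : a `^ (q - 1) <= v.
  have <- : (v `^ (q - 1)^-1) `^ (q - 1) = v.
    by rewrite -powRrM mulVf ?gt_eqF// powRr1// ltW.
  by rewrite ge0_ler_powR// ?nnegrE ltW.
have -> : 1 - q = - (q - 1) by ring.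
rewrite powRN.
have : 1 <= (a `^ (q - 1))^-1 * v by rewrite ler_pdivlMl ?powR_gt0// mulr1.
lra.
Qed.

(** The test at a = l / u, multiplied by [u]. *)
Lemma test_scale q u s v l : 0 < u -> 0 < l ->
  (forall a, 0 < a -> 1 <= a * s + a `^ (1 - q) * v) ->
  u <= l * s + l `^ (1 - q) * (u `^ q * v).
Proof.
move=> u0 l0 /(_ _ (divr_gt0 l0 u0)); rewrite -(ler_pM2l u0) mulr1 mulrDr => T.
apply: le_trans T _; rewrite le_eqVlt; apply/orP; left; apply/eqP.
have -> : u * (l / u * s) = l * s by field; rewrite gt_eqF.
congr (_ + _); rewrite powRM ?invr_ge0 ?(ltW l0) ?(ltW u0)// -(powR_oppV _ u0).
have -> : u `^ q = u * u `^ (- (1 - q)).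
  rewrite -{2}(powRr1 (ltW u0)) -powRD; first by congr (_ `^ _); lra.
  by apply/implyP => _; rewrite gt_eqF.
by ring.
Qed.

(** The conditions on phi(x, .) for fixed [x]. Each is linear in [w], so averages over an atom
    inherit them with the same constants. *)
Definition growth (C p p' : R) (w : R -> R) : Prop :=
  [/\ w 0 = 0, forall s t, 0 <= s -> s <= t -> w s <= w t,
      forall s t, 0 < s < 1 -> 0 <= t -> w (s * t) <= C * s `^ p * w t &
      forall s t, 1 <= s -> 0 <= t -> w (s * t) <= C * s `^ p' * w t].

Lemma growth_ge0 C p p' w t : growth C p p' w -> 0 <= t -> 0 <= w t.
Proof. by case=> w0 wm _ _ t0; rewrite -w0; apply: wm. Qed.

(** The lower type needs a ratio below 1 while [h] may be smaller than [t]: it is applied between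
    [t] and [2 * h], and the upper type returns from [2 * h] to [h]. The surplus power (t/h)^(p-q)
    makes the later sum over levels converge. *)
Lemma growth_below C p p' q w h t : 0 <= C -> 0 <= p -> growth C p p' w ->
  0 < t -> t / 2 < h ->
  h `^ q * w t <= C ^+ 2 * 2 `^ p' * t `^ q * (t / h) `^ (p - q) * w h.
Proof.
move=> C0 p0 gw t0 th; have [w0 wm wl wu] := gw.
have h0 : 0 < h by lra.
have w1 : w t <= C * (t / (2 * h)) `^ p * w (2 * h).
  have {1}-> : t = (t / (2 * h)) * (2 * h) by field; rewrite gt_eqF.
  apply: wl; last lra.
  by rewrite divr_gt0 ?ltr_pdivrMr; lra.
have w2 : w (2 * h) <= C * 2 `^ p' * w h by apply: wu; lra.
have w3 : (t / (2 * h)) `^ p <= (t / h) `^ p.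
  rewrite ge0_ler_powR// ?nnegrE; try by rewrite divr_ge0; lra.
  rewrite ler_pM2l// lef_pV2 ?posrE; lra.
have wh := growth_ge0 gw (ltW h0).
have w4 : w t <= C ^+ 2 * 2 `^ p' * (t / h) `^ p * w h.
  apply: le_trans w1 _.
  apply: (@le_trans _ _ (C * (t / h) `^ p * (C * 2 `^ p' * w h))).
    apply: ler_pM => //; try by rewrite ?mulr_ge0 ?powR_ge0.
      by apply: growth_ge0 gw _; lra.
    by rewrite ler_wpM2l.
  by rewrite le_eqVlt; apply/orP; left; apply/eqP; ring.
have -> : C ^+ 2 * 2 `^ p' * t `^ q * (t / h) `^ (p - q) * w h =
   h `^ q * (C ^+ 2 * 2 `^ p' * (t / h) `^ p * w h).
  have -> : (t / h) `^ (p - q) = (t / h) `^ p * (h `^ q / t `^ q).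
    rewrite powRD; last by apply/implyP => _; rewrite gt_eqF// divr_gt0.
    rewrite powR_oppV ?divr_gt0// invf_div; congr (_ * _).
    by rewrite powRM ?invr_ge0 ?(ltW t0) ?(ltW h0)// -(powR_oppV _ t0) powRN.
  by field; rewrite gt_eqF// powR_gt0.
by rewrite ler_wpM2l// powR_ge0.
Qed.

(* Take [m = k.+1 * i]; Bernoulli bounds [i * r ^+ i], and one of the [k.+1]
   factors [r ^+ i] is spare and tends to 0. *)
Lemma expr_beats_power r C p : 0 < r < 1 -> 0 <= C ->
  exists m : nat, (0 < m)%N /\ r ^+ m * (C * (5 / 4 * m.+1%:R) `^ p) <= 2^-1.
Proof.
move=> /andP[r0 r1] C0.
pose k := Num.truncn p; have pk : p <= k.+1%:R by exact/ltW/truncnS_gt.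
have ri1 : 1 < r^-1 by rewrite invf_gt1.
pose B := (r^-1 - 1)^-1; have B0 : 0 < B by rewrite invr_gt0; lra.
have bern (i : nat) : i%:R * r ^+ i <= B.
  have H : 1 + i%:R * (r^-1 - 1) <= r^-1 ^+ i.
    elim: i => [|i IH]; first by rewrite expr0 mul0r addr0.
    rewrite exprS -natr1; set x := r^-1 in ri1 IH *.
    have i0 : 0 <= i%:R :> R by [].
    have : x * (1 + i%:R * (x - 1)) <= x * x ^+ i by rewrite ler_wpM2l; lra.
    have : 0 <= i%:R * ((x - 1) * (x - 1)) by rewrite !mulr_ge0//; lra.
    lra.
  rewrite exprVn in H.
  have H' : i%:R * (r^-1 - 1) <= (r ^+ i)^-1 by lra.
  rewrite /B -ler_pdivlMr ?exprn_gt0//.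
  rewrite -(ler_pM2r (x := r^-1 - 1)) ?subr_gt0//.
  by rewrite mulrAC mulVf ?mul1r// gt_eqF// subr_gt0.
pose A := C * (4 * k.+2%:R * B) ^+ k.+1 * B.
have A0 : 0 <= A by rewrite !mulr_ge0 ?exprn_ge0// ?mulr_ge0// ltW.
(* The final estimate will be A / i, so i > 2 * A is enough. *)
pose i := (Num.truncn (2 * A)).+1.
have iA : 2 * A < i%:R by exact: truncnS_gt.
exists (k.+2 * i)%N; split=> //.
set m := (k.+2 * i)%N; have m0 : (0 < m)%N by [].
have m1 : 1 <= m%:R :> R by rewrite ler1n.
have mS : m.+1%:R = m%:R + 1 :> R by rewrite -natr1.
have H1 : (5 / 4 * m.+1%:R) `^ p <= (4 * m%:R) ^+ k.+1.
  rewrite -powR_mulrn; last by lra.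
  apply: (@le_trans _ _ ((5 / 4 * m.+1%:R) `^ k.+1%:R)).
    by rewrite ler_powR//; rewrite -natr1; lra.
  by rewrite ge0_ler_powR// ?nnegrE; lra.
apply: (@le_trans _ _ (r ^+ m * (C * (4 * m%:R) ^+ k.+1))).
  by rewrite ler_wpM2l ?exprn_ge0 ?(ltW r0)// ler_wpM2l.
have ri0 : 0 < r ^+ i by rewrite exprn_gt0.
have -> : r ^+ m * (C * (4 * m%:R) ^+ k.+1) =
   C * (4 * k.+2%:R * (i%:R * r ^+ i)) ^+ k.+1 * r ^+ i.
  have -> : r ^+ m = (r ^+ i) ^+ k.+1 * r ^+ i.
    by rewrite /m mulnC exprM exprSr.
  rewrite /m natrM !exprMn; ring.
apply: (@le_trans _ _ (C * (4 * k.+2%:R * B) ^+ k.+1 * r ^+ i)).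
  rewrite ler_wpM2r ?(ltW ri0)// ler_wpM2l// lerXn2r// ?nnegrE.
  - by rewrite !mulr_ge0// exprn_ge0// ltW.
  - by rewrite !mulr_ge0// ltW.
  - by rewrite ler_wpM2l// mulr_ge0.
have i0 : 0 < i%:R :> R by [].
have : r ^+ i <= B / i%:R by rewrite ler_pdivlMr// mulrC.
move=> H; apply: (@le_trans _ _ (C * (4 * k.+2%:R * B) ^+ k.+1 * (B / i%:R))).
  apply: ler_wpM2l => //; apply: mulr_ge0 => //; apply: exprn_ge0.
  by apply: mulr_ge0; [exact: mulr_ge0|exact: ltW].
rewrite mulrA -/A ler_pdivrMr//; lra.
Qed.

Lemma absorb_half (Y N : nat -> R) (c : R) :
  0 <= c -> (forall j, 0 <= Y j) -> (forall j, 0 <= N j) ->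
  Y 0%N <= c * N 0%N -> (forall j, Y j.+1 <= Y j / 2 + c * N j) ->
  forall J, \sum_(j < J) Y j <= 4 * c * \sum_(j < J.+1) N j.
Proof.
move=> c0 Y0 N0 Yz YS.
(* The extra [Y J] closes the induction, because 2 * Y (J+1) <= Y J + 2 * c * N J. *)
have H J : \sum_(j < J.+1) Y j + Y J <= 2 * c * (N 0%N + \sum_(j < J) N j).
  elim: J => [|J IH].
    by rewrite big_ord1 big_ord0; lra.
  rewrite big_ord_recr [in leRHS]big_ord_recr/=; have := YS J.
  by move: (\sum_(j < J.+1) Y j) (\sum_(j < J) N j) IH => A B; lra.
case=> [|J].
  by rewrite big_ord0 big_ord1 mulr_ge0// mulr_ge0.
have S0 : 0 <= \sum_(j < J) N j by apply: sumr_ge0.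
have := H J; have := Y0 J => YJ HJ.
apply: (@le_trans _ _ (2 * c * (N 0%N + \sum_(j < J) N j))); first lra.
have N1 : N 0%N <= \sum_(j < J.+2) N j.
  by rewrite big_ord_recl lerDl; apply: sumr_ge0.
have N2 : \sum_(j < J) N j <= \sum_(j < J.+2) N j.
  by rewrite !big_ord_recr /= -addrA lerDl addr_ge0.
move: (\sum_(j < J) N j) (\sum_(j < J.+2) N j) N1 N2 => A B N1 N2.
have : 2 * c * (N 0%N + A) <= 2 * c * (B + B) by rewrite ler_wpM2l; lra.
lra.
Qed.

(** If [u] exceeds the last level below the top, the last term alone bounds [w u]; otherwise that
    level serves as the new top. *)
Lemma layer_cake (w : R -> R) (lev : nat -> R) u J :
  (forall t, 0 <= t -> 0 <= w t) ->
  (forall s t, 0 <= s -> s <= t -> w s <= w t) -> (forall j, 0 <= lev j) ->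
  0 <= u -> u <= lev J ->
  w u <= w (lev 0%N) + \sum_(j < J) (if lev j < u then w (lev j.+1) else 0).
Proof.
move=> w0 wm l0 u0; elim: J => [|J IH] uJ; first by rewrite big_ord0 addr0 wm.
rewrite big_ord_recr/=; case: ltP => [_|uJ']; last by rewrite addr0 IH.
apply: le_trans (wm _ _ u0 uJ) _; rewrite addrA lerDr addr_ge0 ?w0//.
by apply: sumr_ge0 => j _; case: ifP => // _; exact: w0.
Qed.

(** Read downwards from the largest level below [u], the terms form a convergent geometric series of
    ratio L^(-e). *)
Lemma geometric_below t0 L e u J : 0 < t0 -> 1 < L -> 0 < e ->
  \sum_(j < J) (if t0 * L ^+ j < u then (t0 * L ^+ j) `^ e else 0)
    <= (1 - L `^ (- e))^-1 * u `^ e.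
Proof.
move=> t00 L1 e0.
set r := L `^ (- e).
have r0 : 0 <= r by exact: powR_ge0.
have r1 : r < 1.
  rewrite /r powRN invf_lt1 ?powR_gt0; try lra.
  have := @gt0_ltr_powR _ e e0 1 L; rewrite !nnegrE powR1; apply=> //; lra.
have tp j : 0 < t0 * L ^+ j by rewrite mulr_gt0// exprn_gt0; lra.
have full J' : \sum_(j < J'.+1) (t0 * L ^+ j) `^ e <= (1 - r)^-1 * (t0 * L ^+ J') `^ e.
  rewrite mulrC ler_pdivlMr ?subr_gt0//.
  elim: J' => [|J' IH].
    rewrite big_ord1; have := powR_ge0 (t0 * L ^+ 0) e; nra.
  rewrite big_ord_recr/=.
  have E : (t0 * L ^+ J') `^ e = r * (t0 * L ^+ J'.+1) `^ e.
    rewrite exprSr mulrA (@powRM _ (t0 * L ^+ J')) ?ltW//; last lra.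
    by rewrite mulrCA /r powRN mulVf ?mulr1// gt_eqF// powR_gt0; lra.
  rewrite mulrDl; have := lerD IH (lexx ((t0 * L ^+ J'.+1) `^ e * (1 - r))).
  by rewrite E => /le_trans; apply; lra.
elim: J => [|J IH].
  by rewrite big_ord0 mulr_ge0 ?powR_ge0// invr_ge0; lra.
case: (ltP (t0 * L ^+ J) u) => [Ju|uJ]; last first.
  by rewrite big_ord_recr/= ltNge uJ/= addr0.
apply: (@le_trans _ _ (\sum_(j < J.+1) (t0 * L ^+ j) `^ e)).
  by apply: ler_sum => j _; case: ifP => // _; exact: powR_ge0.
apply: le_trans (full J) _; rewrite ler_wpM2l ?invr_ge0 ?subr_ge0 ?(ltW r1)//.
have := tp J => tJ; rewrite ge0_ler_powR// ?nnegrE; lra.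
Qed.

End Scalar.

(** * The good-lambda inequality on a binary tree *)

Section Tree.
Variable R : realType.

(* The data of one dyadic atom of the finest generation: the average [lg] of a
   function, a bound [lh] for its absolute value, and for each level [t] the
   averages [lw t] of [phi(., t)] and [ls t] of [phi(., t)^(-1/(q-1))]. *)
Record leaf := MkLeaf { lg : R; lh : R; lw : R -> R; ls : R -> R }.

Inductive tree := Leaf of leaf | Node of R & tree & tree.

Implicit Types (l : leaf) (t : tree) (F G : leaf -> R).

Fixpoint av F t : R :=
  match t with Leaf l => F l | Node _ t1 t2 => (av F t1 + av F t2) / 2 end.

(* [d] accumulates the martingale transform along the path from the root. *)
Fixpoint tmod (d : R) t : R :=
  match t with
  | Leaf l => lw l `|d|
  | Node c t1 t2 => let e := c * ((av lg t1 - av lg t2) / 2) in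
      (tmod (d + e) t1 + tmod (d - e) t2) / 2
  end.

(* [F]-mass of the paths on which the transform started from [d] exceeds [La] in
   absolute value, no strict ancestor of the exit node satisfying [stop]. *)
Fixpoint exit F (La : R) (stop : pred R) (d : R) t : R :=
  if La < `|d| then av F t else if stop (av lh t) then 0 else
  match t with
  | Leaf l => 0
  | Node c t1 t2 => let e := c * ((av lg t1 - av lg t2) / 2) in
      (exit F La stop (d + e) t1 + exit F La stop (d - e) t2) / 2
  end.

(** [F]-mass of the set where the dyadic maximal function of [lh] exceeds [th], cut into its topmost
    nodes. *)
Fixpoint maxi F (th : R) t : R :=
  if th < av lh t then av F t else
  match t with
  | Leaf l => 0
  | Node _ t1 t2 => (maxi F th t1 + maxi F th t2) / 2
  end.

Lemma avD F G t : av (fun l => F l + G l) t = av F t + av G t.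
Proof. by elim: t => //= c t1 -> t2 ->; field. Qed.

Lemma avZ (a : R) F t : av (fun l => a * F l) t = a * av F t.
Proof. by elim: t => //= c t1 -> t2 ->; field. Qed.

Lemma av_cst (a : R) t : av (fun=> a) t = a.
Proof. by elim: t => //= c t1 -> t2 ->; field. Qed.

Lemma av_sum n (F : nat -> leaf -> R) t :
  av (fun l => \sum_(j < n) F j l) t = \sum_(j < n) av (F j) t.
Proof.
by elim: t => //= c t1 -> t2 ->; rewrite -big_split/= mulr_suml.
Qed.

Variables (q p p' C K : R).
Hypotheses (q1 : 1 < q) (qp : q < p) (C1 : 1 <= C) (K1 : 1 <= K).

(** A leaf carries averages, so [ls] is no longer a power of [lw]; the test in the last clause is
    what remains of their duality. *)
Definition leaf_ok l : Prop :=
  [/\ `|lg l| <= lh l, growth C p p' (lw l),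
      forall s, 0 < s -> 0 <= ls l s &
      forall s a, 0 < s -> 0 < a -> 1 <= a * ls l s + a `^ (1 - q) * lw l s].

Fixpoint tree_ok t : Prop :=
  (forall s, 0 < s -> av (lw^~ s) t * (av (ls^~ s) t) `^ (q - 1) <= K) /\
  match t with
  | Leaf l => leaf_ok l
  | Node c t1 t2 => [/\ `|c| <= 1, tree_ok t1 & tree_ok t2]
  end.

Lemma tree_okA t s : tree_ok t -> 0 < s ->
  av (lw^~ s) t * (av (ls^~ s) t) `^ (q - 1) <= K.
Proof. by case: t => [l|c t1 t2] [H _]; exact: H. Qed.

Lemma av_le F G t : (forall l, leaf_ok l -> F l <= G l) -> tree_ok t ->
  av F t <= av G t.
Proof.
move=> FG; elim: t => [l|c t1 IH1 t2 IH2] /= [_]; first exact: FG.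
by case=> _ /IH1 H1 /IH2 H2; lra.
Qed.

Lemma av_ge0 F t : (forall l, leaf_ok l -> 0 <= F l) -> tree_ok t -> 0 <= av F t.
Proof. by move=> F0 /(av_le F0); rewrite av_cst. Qed.

Lemma leaf_lw_ge0 s l : 0 <= s -> leaf_ok l -> 0 <= lw l s.
Proof. by move=> s0 [_ /growth_ge0 H _ _]; exact: H. Qed.

Lemma leaf_lh_ge0 l : leaf_ok l -> 0 <= lh l.
Proof. by case=> H _ _ _; apply: le_trans H. Qed.

Lemma norm_av_lg t : tree_ok t -> `|av lg t| <= av lh t.
Proof.
elim: t => [l|c t1 IH1 t2 IH2] /= [_]; first by case.
by case=> _ /IH1 + /IH2; rewrite !ler_norml => /andP[? ?] /andP[? ?]; lra.
Qed.

Lemma exit_ge0 F La stop d t : (forall l, leaf_ok l -> 0 <= F l) -> tree_ok t ->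
  0 <= exit F La stop d t.
Proof.
move=> F0; elim: t d => [l|c t1 IH1 t2 IH2] d /= [_].
  by move=> okl; case: ifP => _; [exact: F0|case: ifP].
move=> [_ ok1 ok2]; case: ifP => _.
  by have := av_ge0 F0 ok1; have := av_ge0 F0 ok2; lra.
case: ifP => // _; set e := c * _.
by have := IH1 (d + e) ok1; have := IH2 (d - e) ok2; lra.
Qed.

Lemma exit_le_av F La stop d t : (forall l, leaf_ok l -> 0 <= F l) ->
  tree_ok t -> exit F La stop d t <= av F t.
Proof.
move=> F0; elim: t d => [l|c t1 IH1 t2 IH2] d /= [_].
  by move=> okl; case: ifP => _ //; case: ifP => _; exact: F0.
move=> [_ ok1 ok2]; case: ifP => _ //.
case: ifP => _; first by have := av_ge0 F0 ok1; have := av_ge0 F0 ok2; lra.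
set e := c * _.
by have := IH1 (d + e) ok1; have := IH2 (d - e) ok2; lra.
Qed.

Lemma exit_le F G La stop d t : (forall l, leaf_ok l -> F l <= G l) ->
  tree_ok t -> exit F La stop d t <= exit G La stop d t.
Proof.
move=> FG; elim: t d => [l|c t1 IH1 t2 IH2] d /= [_].
  by move=> okl; case: ifP => _ //; exact: FG.
move=> [_ ok1 ok2]; case: ifP => _.
  by have := av_le FG ok1; have := av_le FG ok2; lra.
case: ifP => _ //; set e := c * _.
by have := IH1 (d + e) ok1; have := IH2 (d - e) ok2; lra.
Qed.

Lemma exitZ (a : R) F La stop d t :
  exit (fun l => a * F l) La stop d t = a * exit F La stop d t.
Proof.
elim: t d => [l|c t1 IH1 t2 IH2] d /=.
  by case: ifP => _ //; case: ifP => _; rewrite mulr0.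
rewrite !avZ IH1 IH2; case: ifP => _; first by field.
by case: ifP => _; [rewrite mulr0|field].
Qed.

Lemma maxi_ge0 F th t : (forall l, leaf_ok l -> 0 <= F l) -> tree_ok t ->
  0 <= maxi F th t.
Proof.
move=> F0; elim: t => [l|c t1 IH1 t2 IH2] /= [_].
  by move=> okl; case: ifP => _ //; exact: F0.
move=> [_ ok1 ok2]; case: ifP => _.
  by have := av_ge0 F0 ok1; have := av_ge0 F0 ok2; lra.
by have := IH1 ok1; have := IH2 ok2; lra.
Qed.

Lemma maxi_le F G th t : (forall l, leaf_ok l -> F l <= G l) ->
  tree_ok t -> maxi F th t <= maxi G th t.
Proof.
move=> FG; elim: t => [l|c t1 IH1 t2 IH2] /= [_].
  by move=> okl; case: ifP => _ //; exact: FG.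
move=> [_ ok1 ok2]; case: ifP => _.
  by have := av_le FG ok1; have := av_le FG ok2; lra.
by have := IH1 ok1; have := IH2 ok2; lra.
Qed.

Lemma maxiZ (a : R) F th t : maxi (fun l => a * F l) th t = a * maxi F th t.
Proof.
elim: t => [l|c t1 IH1 t2 IH2] /=; first by case: ifP; rewrite ?mulr0.
by rewrite !avZ IH1 IH2; case: ifP => _; field.
Qed.

(* [d ^+ 2 - (av lg t) ^+ 2] is a supermartingale since [|c| <= 1]. *)
Lemma exit_mass_bellman La th d t : 0 < th -> 0 < La -> tree_ok t ->
  av lh t <= 2 * th ->
  exit (fun=> 1) La (fun x => th < x) d t * La ^+ 2 <= d ^+ 2 + 4 * th ^+ 2 - (av lg t) ^+ 2.
Proof.
move=> th0 La0; elim: t d => [l|c t1 IH1 t2 IH2] d okt ht;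
  have gt := norm_av_lg okt.
  have g2 : av lg (Leaf l) ^+ 2 <= 4 * th ^+ 2.
    have -> : 4 * th ^+ 2 = (2 * th) ^+ 2 by ring.
    rewrite -real_normK ?num_real// lerXn2r ?nnegrE//; last exact: le_trans ht.
    by rewrite mulr_ge0// ltW.
  have := sqr_ge0 d => d2 /=; case: ifP => Ld.
    have : La ^+ 2 <= d ^+ 2.
      by rewrite -(real_normK (num_real d)) lerXn2r ?nnegrE// ltW.
    by move=> H; rewrite mul1r -subr_ge0; move: g2 => /=; lra.
  by case: ifP => _; move: g2 => /= g2; lra.
have g2 : av lg (Node c t1 t2) ^+ 2 <= 4 * th ^+ 2.
  have -> : 4 * th ^+ 2 = (2 * th) ^+ 2 by ring.
  rewrite -real_normK ?num_real// lerXn2r ?nnegrE//; last exact: le_trans ht.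
  by rewrite mulr_ge0// ltW.
have := sqr_ge0 d => d2.
case: okt => _ [c1 ok1 ok2].
rewrite [exit]lock /= -lock; case: (ltP La `|d|) => Ld.
  rewrite /= Ld !av_cst.
  have : La ^+ 2 <= d ^+ 2.
    by rewrite -(real_normK (num_real d)) lerXn2r ?nnegrE// ltW.
  by move: g2 => /=; lra.
rewrite /= [La < _]ltNge Ld /=; case: ltP => hth.
  by move: g2 => /=; lra.
have h1 := av_ge0 leaf_lh_ge0 ok1; have h2 := av_ge0 leaf_lh_ge0 ok2.
set e := (av lg t1 - av lg t2) / 2.
have := IH1 (d + c * e) ok1; have := IH2 (d - c * e) ok2.
set E1 := exit _ _ _ _ _; set E2 := exit _ _ _ _ _ => H2 H1.
(* The node is not stopped, so its nonnegative children have mean at most [th], hence each is at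
   most [2 * th]: this is the origin of the factor 2 in the hypothesis. *)
have {H2} H2 := H2 ltac:(lra); have {H1} H1 := H1 ltac:(lra).
have c2 : c ^+ 2 <= 1 by rewrite -(real_normK (num_real c)) expr_le1.
have ce : (c * e) ^+ 2 <= e ^+ 2.
  by rewrite exprMn ler_piMl// sqr_ge0.
have ee : av lg t1 ^+ 2 + av lg t2 ^+ 2 =
    2 * ((av lg t1 + av lg t2) / 2) ^+ 2 + 2 * e ^+ 2 by rewrite /e; field.
have dd : (d + c * e) ^+ 2 + (d - c * e) ^+ 2 = 2 * d ^+ 2 + 2 * (c * e) ^+ 2 by ring.
have -> : (E2 + E1) / 2 * La ^+ 2 = (E2 * La ^+ 2 + E1 * La ^+ 2) / 2 by ring.
lra.
Qed.

(** Chebyshev from [d = 0]: the exit level [4 * th] is chosen so that 4 th^2 / (4 th)^2 = 1/4. *)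
Lemma exit_mass_quarter th t : 0 < th -> tree_ok t -> av lh t <= 2 * th ->
  exit (fun=> 1) (4 * th) (fun x => th < x) 0 t <= 4^-1.
Proof.
move=> th0 okt ht; have := @exit_mass_bellman (4 * th) th 0 t th0 _ okt ht.
have th2 : 0 < th ^+ 2 by rewrite exprn_gt0.
have := sqr_ge0 (av lg t) => g2 /(_ ltac:(lra)).
set E := exit _ _ _ _ _; rewrite expr0n/= exprMn => H.
rewrite -(ler_pM2r th2); lra.
Qed.

Lemma leaf_test s a l : 0 < s -> 0 < a -> leaf_ok l ->
  1 <= a * ls l s + a `^ (1 - q) * lw l s.
Proof. by move=> s0 a0 [_ _ _ H]; exact: H. Qed.

Lemma leaf_ls_ge0 s l : 0 < s -> leaf_ok l -> 0 <= ls l s.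
Proof. by move=> s0 [_ _ H _]; exact: H. Qed.

(** The leaf test averaged over the paths that do not exit; on the others only the sign of [ls] is
    used. *)
Lemma exit_test s a La stop d t : 0 < s -> 0 < a -> tree_ok t ->
  1 - exit (fun=> 1) La stop d t <=
  a * av (ls^~ s) t + a `^ (1 - q) * (av (lw^~ s) t - exit (lw^~ s) La stop d t).
Proof.
move=> s0 a0; elim: t d => [l|c t1 IH1 t2 IH2] d okt.
  case: okt => _ okl /=; have := leaf_test s0 a0 okl; have := leaf_ls_ge0 s0 okl.
  move=> S0 T; case: ifP => _; last by case: ifP => _; lra.
  by rewrite !subrr mulr0 addr0 mulr_ge0// ltW.
have S0 := av_ge0 (fun l => @leaf_ls_ge0 s l s0) okt.
have := av_le (fun l => @leaf_test s a l s0 a0) okt.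
rewrite av_cst avD !avZ => T.
case: okt => _ [_ ok1 ok2]; rewrite [exit]lock [av]lock /= -!lock.
rewrite /= in S0 T *; case: ifP => _.
  by rewrite !av_cst subrr mulr0 addr0; have : 0 <= a * _ := mulr_ge0 (ltW a0) S0; lra.
case: ifP => _; first by lra.
set e := c * _; have := IH1 (d + e) ok1; have := IH2 (d - e) ok2.
set A := a `^ _; lra.
Qed.

(** [Aq_test] with a = 1/2 shows that the non-exiting paths carry at least the fraction 1 / (4^q K)
    of every weight. *)
Definition rho : R := 1 - (4 `^ q * K)^-1.

Lemma rho_itv : 0 < rho < 1.
Proof.
have q4 : 4 <= 4 `^ q * K.
  have : 4 `^ 1 <= 4 `^ q :> R by rewrite ler_powR ?ltW//; lra.
  rewrite powRr1// => H; rewrite -[leLHS]mulr1; apply: ler_pM => //.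
have i4 : (4 `^ q * K)^-1 <= 4^-1 by rewrite lef_pV2// posrE; lra.
have : 0 < (4 `^ q * K)^-1 by rewrite invr_gt0; lra.
by rewrite /rho; lra.
Qed.

Lemma exit_weight th s t : 0 < th -> 0 < s -> tree_ok t -> av lh t <= 2 * th ->
  exit (lw^~ s) (4 * th) (fun x => th < x) 0 t <= rho * av (lw^~ s) t.
Proof.
move=> th0 s0 okt ht.
have w0 := fun l => @leaf_lw_ge0 s l (ltW s0).
set X := exit _ _ _ _ _; set W := av _ _.
have XW : X <= W by exact: exit_le_av.
(* The non-exiting paths have Lebesgue mass at least 3/4, so the value 1/2 can be tested. *)
have := @Aq_test R q K (av (ls^~ s) t) W (W - X) 2^-1 q1.
move/(_ (av_ge0 (fun l => @leaf_ls_ge0 s l s0) okt) (av_ge0 w0 okt)).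
rewrite subr_ge0 => /(_ XW (tree_okA okt s0) ltac:(lra)) H.
have {H} : 2^-1 `^ q * W <= 2 `^ q * K * (W - X).
  apply: H => a a0; apply: le_trans (@exit_test s a (4 * th) (fun x => th < x) 0 t s0 a0 okt).
  by have := exit_mass_quarter th0 okt ht; lra.
have p2 : 0 < 2 `^ q :> R by rewrite powR_gt0.
rewrite -powR_oppV// powRN ler_pdivrMl// mulrA => H.
have E : 4 `^ q = 2 `^ q * 2 `^ q :> R.
  by rewrite -powRM//; congr (_ `^ _); lra.
have kp : 0 < 4 `^ q * K by rewrite mulr_gt0 ?powR_gt0//; exact: lt_le_trans K1.
have : (4 `^ q * K)^-1 * W <= W - X.
  by rewrite ler_pdivrMl//; move: H; rewrite E; lra.
rewrite /rho; lra.
Qed.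

(* Strong Markov property at the first exit from [-4 th, 4 th]: the transform
   then is at most [5 th] because its increments are dominated by [lh]. *)
Lemma exit_markov F th La (r : R) (stop : pred R) d e t :
  0 < th -> 0 <= r -> (forall l, leaf_ok l -> 0 <= F l) ->
  (forall x, stop x -> th < x) ->
  (forall t' d', tree_ok t' -> av lh t' <= 2 * th -> `|d'| <= `|d| + 5 * th ->
     exit F La (fun x => th < x) d' t' <= r * av F t') ->
  `|d| + 5 * th <= La -> `|e| <= 5 * th -> tree_ok t -> av lh t <= 2 * th ->
  exit F La (fun x => th < x) (d + e) t <= r * exit F (4 * th) stop e t.
Proof.
move=> th0 r0 F0 stopP HF dLa; elim: t e => [l|c t1 IH1 t2 IH2] e e5 okt ht.
  have de : `|d + e| <= `|d| + 5 * th.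
    by apply: le_trans (ler_normD _ _) _; lra.
  rewrite [X in _ <= _ * X]/=; case: ifP => He.
    exact: HF.
  rewrite /= ltNge (le_trans de dLa)/=.
  by case: ifP => _; case: ifP => _; rewrite mulr0.
have de : `|d + e| <= `|d| + 5 * th.
  by apply: le_trans (ler_normD _ _) _; lra.
rewrite [X in _ <= _ * X]/=; case: (ltP (4 * th) `|e|) => He.
  exact: HF.
have r1 := exit_ge0 (4 * th) stop e F0 okt.
move: r1; rewrite /= ltNge He/= => r1.
rewrite ltNge (le_trans de dLa)/=.
case: ltP => hth; first exact: mulr_ge0.
case: ifP => [/stopP|_]; first by rewrite ltNge hth.
have gt := norm_av_lg okt.
case: okt => _ [c1 ok1 ok2].
have h1 := av_ge0 leaf_lh_ge0 ok1; have h2 := av_ge0 leaf_lh_ge0 ok2.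
have := norm_av_lg ok1; have := norm_av_lg ok2 => g2 g1.
set x := c * _.
(* The half-difference of the children's averages of [lg] is at most the average of [lh] over the
   node, which is at most [th] before stopping. *)
have xth : `|x| <= th.
  rewrite /x normrM; apply: (@le_trans _ _ (1 * `|(av lg t1 - av lg t2) / 2|)).
    exact: ler_wpM2r.
  move: hth g1 g2; rewrite mul1r !ler_norml /= => ? /andP[? ?] /andP[? ?].
  by apply/andP; split; lra.
have H1 := IH1 (e + x) _ ok1 ltac:(lra); have H2 := IH2 (e - x) _ ok2 ltac:(lra).
rewrite -!addrA; move: H1 H2.
have e1 : `|e + x| <= 5 * th by apply: le_trans (ler_normD _ _) _; lra.
have e2 : `|e - x| <= 5 * th by apply: le_trans (ler_normB _ _) _; lra.
move=> /(_ e1) H1 /(_ e2) H2.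
rewrite mulrA mulrDr; lra.
Qed.

(** Leaving a window of half-width [4 * th] around the current value costs a factor [rho] and moves
    the transform by at most [5 * th]; the room up to [La] allows [m] such passages. *)
Lemma exit_decay th s La m d t : 0 < th -> 0 < s -> tree_ok t ->
  av lh t <= 2 * th -> `|d| + m%:R * (5 * th) <= La ->
  exit (lw^~ s) La (fun x => th < x) d t <= rho ^+ m * av (lw^~ s) t.
Proof.
move=> th0 s0; have w0 := fun l => @leaf_lw_ge0 s l (ltW s0).
have /andP[rho0 rho1] := rho_itv.
elim: m d t => [|m IH] d t okt ht dLa.
  by rewrite expr0 mul1r exit_le_av.
have m0 : 0 <= m%:R :> R by [].
rewrite -natr1 in dLa.
have mth : 0 <= m%:R * (5 * th) by rewrite mulr_ge0//; lra.
rewrite exprSr -mulrA; have rm : 0 <= rho ^+ m by rewrite exprn_ge0// ltW.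
apply: (le_trans _ (ler_wpM2l rm (exit_weight th0 s0 okt ht))).
rewrite -[X in exit _ _ _ X _]addr0.
apply: exit_markov => //.
- by move=> t' d' okt' ht' d'1; apply: IH => //; lra.
- lra.
- by rewrite normr0; lra.
Qed.

(** A path that exits only after being stopped runs below a node with [th < av lh], whose whole mass
    is counted in [maxi]. *)
Lemma exit_le_exit_maxi F La th d t : (forall l, leaf_ok l -> 0 <= F l) ->
  tree_ok t -> exit F La xpred0 d t <= exit F La (fun x => th < x) d t + maxi F th t.
Proof.
move=> F0; elim: t d => [l|c t1 IH1 t2 IH2] d okt.
  have := F0 _ okt.2; rewrite /= => Fl.
  by do 2![case: ifP => _]; rewrite ?addr0 ?add0r ?lerDl//; lra.
have m0 := maxi_ge0 th F0 okt; have a0 := av_ge0 F0 okt.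
have e0 := exit_le_av La xpred0 d F0 okt.
move: m0 a0 e0; rewrite /=; case: ifP => _; first by case: ifP; lra.
case: ifP => _; first lra.
case: okt => _ [_ ok1 ok2] _ _ _; set e := c * _.
have := IH1 (d + e) ok1; have := IH2 (d - e) ok2; lra.
Qed.

(** The first passage above [4 * th] lands within [5 * th]; the remaining distance [5 * m * th]
    gives the [m] factors [rho]. *)
Lemma good_lambda th s m t : 0 < th -> 0 < s -> tree_ok t ->
  exit (lw^~ s) (5 * m.+1%:R * th) xpred0 0 t <=
  rho ^+ m * exit (lw^~ s) (4 * th) xpred0 0 t + maxi (lw^~ s) th t.
Proof.
move=> th0 s0 okt; have w0 := fun l => @leaf_lw_ge0 s l (ltW s0).
have /andP[rho0 rho1] := rho_itv.
have rm : 0 <= rho ^+ m by rewrite exprn_ge0// ltW.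
have m0 : 0 <= m%:R :> R by [].
have mth : 0 <= m%:R * th by rewrite mulr_ge0//; lra.
apply: le_trans (exit_le_exit_maxi _ th _ w0 okt) _; rewrite lerD2r.
case: (leP (av lh t) th) => hth; last first.
  (* A root that is stopped at once lets no path exit, since the transform starts at 0. *)
  have -> : exit (lw^~ s) (5 * m.+1%:R * th) (fun x => th < x) 0 t = 0.
    have L0 : (5 * m.+1%:R * th < `|0 : R|) = false.
      by rewrite ltNge normr0 !mulr_ge0// ltW.
    by case: (t) hth => [l|c t1 t2] /= ->; rewrite L0.
  by rewrite mulr_ge0// exit_ge0.
rewrite -[X in exit _ _ (fun x => th < x) X _]addr0.
apply: exit_markov => //; rewrite -?natr1 ?normr0; try lra.
by move=> t' d' okt' ht' d'1; apply: exit_decay => //; lra.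
Qed.

(** Weak type at a single level. On a node of average above [s], the part with [lh <= s / 2]
    contributes at most [s / 2], so [Aq_test] applies to the rest with [a = s / 2]; the topmost such
    nodes are then added up. *)
Lemma maxi_bound s t : 0 < s -> tree_ok t ->
  maxi (lw^~ s) s t <=
  4 `^ q * K * av (fun l => if s / 2 < lh l then lh l `^ q * lw l s / s `^ q else 0) t.
Proof.
move=> s0; have w0 := fun l => @leaf_lw_ge0 s l (ltW s0).
set H := (X in av X _).
have H0 l : leaf_ok l -> 0 <= H l.
  move=> okl; rewrite /H; case: ifP => // _.
  by rewrite divr_ge0 ?mulr_ge0 ?powR_ge0 ?w0.
have k0 : 0 <= 4 `^ q * K by rewrite mulr_ge0 ?powR_ge0// (le_trans ler01 K1).
have sq0 : 0 < s `^ q by rewrite powR_gt0.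
have large t' : tree_ok t' -> s < av lh t' -> av (lw^~ s) t' <= 4 `^ q * K * av H t'.
  move=> okt st.
  have := @Aq_test R q K (av (ls^~ s) t') (av (lw^~ s) t') (s `^ q * av H t') (s / 2) q1.
  move/(_ (av_ge0 (fun l => @leaf_ls_ge0 s l s0) okt) (av_ge0 w0 okt)).
  move/(_ (mulr_ge0 (ltW sq0) (av_ge0 H0 okt)) (tree_okA okt s0) ltac:(lra)) => T.
  have {T} : (s / 2) `^ q * av (lw^~ s) t' <= 2 `^ q * K * (s `^ q * av H t').
    apply: T => a a0.
    have : av lh t' <= av (fun l => s / 2 + (a * ls l s + a `^ (1 - q) * (s `^ q * H l))) t'.
      apply: av_le => // l okl; have h0 := leaf_lh_ge0 okl.
      have S0 := leaf_ls_ge0 s0 okl.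
      have aS : 0 <= a * ls l s by rewrite mulr_ge0// ltW.
      rewrite /H; case: ltP => hs; last by rewrite !mulr0; lra.
      have hp : 0 < lh l by lra.
      have := test_scale hp a0 (fun b b0 => leaf_test s0 b0 okl).
      have -> : s `^ q * (lh l `^ q * lw l s / s `^ q) = lh l `^ q * lw l s.
        by field; rewrite gt_eqF.
      lra.
    by rewrite !avD av_cst !avZ; lra.
  rewrite powRM ?invr_ge0 ?(ltW s0)// -powR_oppV// powRN.
  have p2 : 0 < 2 `^ q :> R by rewrite powR_gt0.
  have E : 4 `^ q = 2 `^ q * 2 `^ q :> R.
    by rewrite -powRM//; congr (_ `^ _); lra.
  rewrite mulrAC ler_pdivrMr// => T.
  rewrite -(ler_pM2l sq0) E; apply: le_trans T _.
  by rewrite le_eqVlt; apply/orP; left; apply/eqP; ring.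
elim: t => [l|c t1 IH1 t2 IH2] okt.
  have := large _ okt; have := H0 _ okt.2; rewrite /=.
  by case: ltP => [_ _ |_ Hl _]; [exact|exact: mulr_ge0].
have := large _ okt; rewrite [maxi _ _ _]/=; case: ltP => [_|_ _]; first exact.
case: okt => _ [_ /IH1 H1 /IH2 H2].
by rewrite /=; lra.
Qed.

(** Only serves to bound the number of levels needed. *)
Fixpoint path_sup (d : R) t : R :=
  match t with
  | Leaf _ => `|d|
  | Node c t1 t2 => let e := c * ((av lg t1 - av lg t2) / 2) in
      Num.max (path_sup (d + e) t1) (path_sup (d - e) t2)
  end.

Lemma tmod_layer_cake (lev : nat -> R) J d t : (forall j, 0 <= lev j) ->
  tree_ok t -> path_sup d t <= lev J ->
  tmod d t <= av (lw^~ (lev 0%N)) t +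
    \sum_(j < J) exit (lw^~ (lev j.+1)) (lev j) xpred0 d t.
Proof.
move=> l0; elim: t d => [l|c t1 IH1 t2 IH2] d okt.
  rewrite /= => dJ.
  have [_ gl _ _] := okt.2; have [_ wm _ _] := gl.
  have := @layer_cake R (lw l) lev `|d| J _ wm l0 (normr_ge0 d) dJ.
  by apply=> x x0; exact: growth_ge0 gl x0.
rewrite [path_sup _ _]/= ge_max => /andP[d1 d2].
have ok' := okt; case: okt => _ [_ ok1 ok2].
have := IH1 _ ok1 d1; have := IH2 _ ok2 d2; set e := c * _ in d1 d2 * => H2 H1.
have -> : tmod d (Node c t1 t2) = (tmod (d + e) t1 + tmod (d - e) t2) / 2 by [].
have : \sum_(j < J) (exit (lw^~ (lev j.+1)) (lev j) xpred0 (d + e) t1 +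
    exit (lw^~ (lev j.+1)) (lev j) xpred0 (d - e) t2) / 2
  <= \sum_(j < J) exit (lw^~ (lev j.+1)) (lev j) xpred0 d (Node c t1 t2).
  apply: ler_sum => j _.
  have w0 := fun l => @leaf_lw_ge0 (lev j.+1) l (l0 j.+1).
  rewrite /=; case: ifP => _ //.
  have := exit_le_av (lev j) xpred0 (d + e) w0 ok1.
  have := exit_le_av (lev j) xpred0 (d - e) w0 ok2.
  lra.
rewrite -mulr_suml big_split/=; lra.
Qed.

(** The case excluded when the levels are scaled by the root average of [lh]: all averages of [lg]
    vanish and the transform never moves. *)
Lemma tmod_null d t : tree_ok t -> av lh t = 0 -> tmod d t = av (lw^~ `|d|) t.
Proof.
elim: t d => [//|c t1 IH1 t2 IH2] d [_ [_ ok1 ok2]] /= h0.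
have h1 := av_ge0 leaf_lh_ge0 ok1; have h2 := av_ge0 leaf_lh_ge0 ok2.
have h1z : av lh t1 = 0 by lra.
have h2z : av lh t2 = 0 by lra.
have := norm_av_lg ok1; have := norm_av_lg ok2.
rewrite h1z h2z !normr_le0 => /eqP -> /eqP ->.
by rewrite subrr mul0r mulr0 subr0 addr0 IH1 ?IH2.
Qed.

Lemma tree_bound : exists B : R, 0 < B /\
  forall t, tree_ok t -> tmod 0 t <= B * av (fun l => lw l (lh l)) t.
Proof.
have C0 : 0 <= C by exact: le_trans C1.
have [m [m0 Hm]] := expr_beats_power p' rho_itv C0.
have /andP[rho0 rho1] := rho_itv.
pose L : R := 5 / 4 * m.+1%:R.
have L2 : 2 <= L.
  have : 1 <= m%:R :> R by rewrite ler1n.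
  by rewrite /L -natr1; lra.
have L0 : 0 < L by lra.
pose e := p - q; have e0 : 0 < e by rewrite subr_gt0.
pose c2 : R := C * (4 * L ^+ 2) `^ p'.
have c20 : 0 <= c2 by rewrite mulr_ge0 ?powR_ge0.
have k0 : 0 <= 4 `^ q * K by rewrite mulr_ge0 ?powR_ge0// (le_trans ler01 K1).
(* Constant of [growth_below] times that of [geometric_below]; 2^e comes from the argument
   [2 * lh l]. *)
pose c3 : R := C ^+ 2 * 2 `^ p' * (2 `^ e * (1 - L `^ (- e))^-1).
have c30 : 0 <= c3.
  rewrite /c3 !mulr_ge0 ?powR_ge0 ?exprn_ge0// invr_ge0 subr_ge0.
  rewrite powRN invf_le1 ?powR_gt0// -[leLHS](powRr0 L).
  by apply: ler_powR; [lra|exact: ltW].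
have B0 : 0 <= 5 * c2 * (4 `^ q * K) * c3 by do 3![apply: mulr_ge0 => //].
exists (5 * c2 * (4 `^ q * K) * c3 + 1); split; first by rewrite ltr_wpDl.
move=> t okt.
have wh0 : 0 <= av (fun l => lw l (lh l)) t.
  by apply: av_ge0 => // l okl; exact: leaf_lw_ge0 (leaf_lh_ge0 okl) okl.
have h0 := av_ge0 leaf_lh_ge0 okt.
have [hz|hnz] := eqVneq (av lh t) 0.
  rewrite tmod_null// normr0.
  have -> : av (lw^~ 0) t = 0.
    have : av (lw^~ 0) t <= av (fun=> 0) t.
      by apply: av_le => // l [_ [-> _ _ _] _ _].
    have := av_ge0 (fun l => @leaf_lw_ge0 0 l (lexx 0)) okt.
    by rewrite av_cst; lra.
  by rewrite mulr_ge0// addr_ge0.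
have tp : 0 < av lh t by rewrite lt_neqAle eq_sym hnz.
pose lev j := av lh t * L ^+ j.
have lp j : 0 < lev j by rewrite /lev mulr_gt0// exprn_gt0.
pose J := (Num.truncn (path_sup 0 t / av lh t)).+1.
have rJ : path_sup 0 t <= lev J.
  have : path_sup 0 t / av lh t < J%:R by exact: truncnS_gt.
  rewrite ltr_pdivrMr// mulrC => /ltW/le_trans; apply.
  rewrite /lev ler_pM2l//; apply: (@le_trans _ _ (2 ^+ J)).
    by rewrite -natrX ler_nat ltnW// ltn_expl.
  by rewrite lerXn2r// ?nnegrE; lra.
have := tmod_layer_cake (fun j => ltW (lp j)) okt rJ.
pose Y j := exit (lw^~ (lev j.+1)) (lev j) xpred0 0 t.
pose N j := maxi (lw^~ (lev j / 4)) (lev j / 4) t.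
have lp4 j : 0 < lev j / 4 by rewrite divr_gt0.
have N0 j : 0 <= N j.
  by apply: maxi_ge0 => // l; apply: leaf_lw_ge0; exact: ltW.
have Y0 j : 0 <= Y j.
  by apply: exit_ge0 => // l; apply: leaf_lw_ge0; exact: ltW.
have LL : 4 * L <= 4 * L ^+ 2 by rewrite ler_pM2l// expr2; nra.
(* Price of raising the weight from level [lev j / 4]: shifts 0 and 1 start the recursion, shift 2
   is the good-lambda step. *)
have up j i : (i <= 2)%N -> forall l, leaf_ok l ->
    lw l (lev (j + i)%N) <= c2 * lw l (lev j / 4).
  move=> i2 l [_ [_ wm _ wu] _ _].
  apply: (@le_trans _ _ (lw l (4 * L ^+ 2 * (lev j / 4)))).
    apply: wm; first exact: ltW.
    have -> : lev (j + i)%N = 4 * L ^+ i * (lev j / 4).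
      by rewrite /lev exprD; field.
    rewrite ler_pM2r// ler_pM2l//; apply: ler_weXn2l => //; lra.
  by apply: wu; [lra|exact: ltW].
(* Levels start at the root average of [lh], so the root already exceeds [lev 0 / 4] and [N 0] is
   the full weight. *)
have NN0 : av (lw^~ (lev 0%N / 4)) t = N 0%N.
  have : lev 0%N / 4 < av lh t by rewrite /lev expr0; lra.
  by rewrite /N; case: (t) => [l|c t1 t2] /= ->.
have W0 : av (lw^~ (lev 0%N)) t <= c2 * N 0%N.
  rewrite -NN0 -avZ; apply: av_le => // l okl; exact: (@up 0%N 0%N).
have Yz : Y 0%N <= c2 * N 0%N.
  rewrite -NN0 -avZ; apply: (@le_trans _ _ (av (lw^~ (lev 1%N)) t)).
    by apply: exit_le_av => // l; apply: leaf_lw_ge0; exact: ltW.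
  by apply: av_le => // l okl; exact: (@up 0%N 1%N).
(* With [th = lev j / 4] the two exit levels are [lev j] and [lev (j+1)]. Lowering the weight by one
   level costs C * L^p', which rho^m brings below 1/2. *)
have YS j : Y j.+1 <= Y j / 2 + c2 * N j.
  have := @good_lambda (lev j / 4) (lev j.+2) m t (lp4 j) (lp _) okt.
  have -> : 5 * m.+1%:R * (lev j / 4) = lev j.+1.
    by rewrite /lev exprSr /L; field.
  have -> : 4 * (lev j / 4) = lev j by field.
  rewrite -/(Y j.+1); move/le_trans; apply; apply: lerD.
    have : exit (lw^~ (lev j.+2)) (lev j) xpred0 0 t <= C * L `^ p' * Y j.
      rewrite -exitZ; apply: exit_le => // l [_ [_ _ _ wu] _ _].
      have -> : lev j.+2 = L * lev j.+1 by rewrite /lev exprS; ring.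
      by apply: wu; [lra|exact: ltW].
    have rm : 0 <= rho ^+ m by rewrite exprn_ge0// ltW.
    move=> /(ler_wpM2l rm)/le_trans; apply.
    by rewrite mulrA (mulrC (Y j)) ler_wpM2r.
  rewrite -maxiZ; apply: maxi_le => // l okl.
  by have := @up j 2%N isT l okl; rewrite addn2.
have SY := absorb_half c20 Y0 N0 Yz YS J.
have SN : \sum_(j < J.+1) N j <= 4 `^ q * K * (c3 * av (fun l => lw l (lh l)) t).
  apply: (@le_trans _ _ (\sum_(j < J.+1) (4 `^ q * K *
     av (fun l => if lev j / 4 / 2 < lh l then
       lh l `^ q * lw l (lev j / 4) / (lev j / 4) `^ q else 0) t))).
    by apply: ler_sum => j _; exact: maxi_bound.
  rewrite -mulr_sumr ler_wpM2l//.
  rewrite -(av_sum _ (fun j l => if lev j / 4 / 2 < lh l then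
       lh l `^ q * lw l (lev j / 4) / (lev j / 4) `^ q else 0)) -avZ.
  apply: av_le => // l okl; have hl := leaf_lh_ge0 okl.
  have [_ gl _ _] := okl.
  have wl : 0 <= lw l (lh l) by exact: growth_ge0 gl hl.
  have [hl0|hlp] := leP (lh l) 0.
    rewrite big1 => [|j _]; first exact: mulr_ge0.
    rewrite ifF//.
    by apply/negbTE; rewrite -leNgt (le_trans hl0)// ltW// divr_gt0.
  (* The cut [lev j / 8 < lh l] reads [lev j / 4 < 2 * lh l]; the exponent [e = p - q] is positive
     by [q < p]. *)
  have geo := @geometric_below R (av lh t / 4) L e (2 * lh l) J.+1
    ltac:(by rewrite divr_gt0) ltac:(lra) e0.
  have -> : c3 * lw l (lh l) = C ^+ 2 * 2 `^ p' * lw l (lh l) * (lh l `^ e)^-1 *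
      ((1 - L `^ (- e))^-1 * (2 * lh l) `^ e).
    rewrite /c3 (@powRM _ 2)//.
    have nz : lh l `^ e != 0 by rewrite gt_eqF// powR_gt0.
    by move: (_^-1) => r; field.
  apply: le_trans (ler_wpM2l _ geo); last first.
    by rewrite !mulr_ge0 ?exprn_ge0 ?powR_ge0// invr_ge0 powR_ge0.
  rewrite mulr_sumr; apply: ler_sum => j _.
  have E : av lh t / 4 * L ^+ j = lev j / 4 by rewrite /lev; ring.
  rewrite E.
  case: ltP => H1; case: ltP => H2; rewrite ?mulr0//; try lra.
  rewrite ler_pdivrMr ?powR_gt0//.
  apply: le_trans (@growth_below R C p p' q (lw l) (lh l) (lev j / 4) C0 _ gl (lp4 j) H1) _.
    by have := qp; have := q1; lra.
  have -> : (lev j / 4 / lh l) `^ (p - q) = (lev j / 4) `^ e / lh l `^ e.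
    by rewrite powRM ?invr_ge0 ?(ltW (lp4 j))// -(powR_oppV _ hlp) powRN.
  by rewrite le_eqVlt; apply/orP; left; apply/eqP; ring.
have N1 : N 0%N <= \sum_(j < J.+1) N j.
  by rewrite big_ord_recl lerDl; apply: sumr_ge0.
have c2N : c2 * N 0%N <= c2 * \sum_(j < J.+1) N j by rewrite ler_wpM2l.
move: (\sum_(j < J.+1) N j) (\sum_(j < J) Y j) SY SN c2N => A D SY SN c2N.
move=> H; apply: le_trans H _.
apply: (@le_trans _ _ (5 * c2 * A)); first by rewrite -/(Y _); lra.
apply: (@le_trans _ _ (5 * c2 * (4 `^ q * K * (c3 * av (fun l => lw l (lh l)) t)))).
  by rewrite ler_wpM2l// mulr_ge0.
lra.
Qed.

End Tree.

(** * Dyadic atoms and Walsh functions *)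

Section Dyadic.
Variable R : realType.
Local Notation mu := (@lebesgue_measure R).
Local Notation rad := Pilot.Defs.rad.
Implicit Types (g f : R -> R) (x y : R).

(** Indexed by [k] instead of a point, so that the children of [k] are [k.*2] and [k.*2.+1]. *)
Definition atom (n k : nat) : set R := `[k%:R / 2 ^+ n, k.+1%:R / 2 ^+ n[.

Definition average (n k : nat) g : R := 2 ^+ n * Rintegral mu (atom n k) g.

Lemma atomP n k x : atom n k x <-> k%:R <= 2 ^+ n * x < k.+1%:R.
Proof.
have p0 : 0 < 2 ^+ n :> R by rewrite exprn_gt0.
by rewrite /atom /= in_itv/= ler_pdivrMr// ltr_pdivlMr// (mulrC x).
Qed.

Lemma measurable_atom n k : @measurable _ (measurableTypeR R) (atom n k).
Proof. exact: measurable_itv. Qed.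
Hint Resolve measurable_atom : core.

Lemma mu_atom n k : mu (atom n k) = (2 ^- n)%:E.
Proof.
have p0 : 0 < 2 ^+ n :> R by rewrite exprn_gt0.
rewrite /atom lebesgue_measure_itv/= lte_fin ltr_pM2r ?invr_gt0// ltr_nat ltnSn.
by rewrite -EFinB -mulrBl -natrB// subSnn mul1r.
Qed.

Lemma I01E : @I01 R = atom 0 0.
Proof. by rewrite /I01 /atom expr0 !divr1. Qed.

Lemma measurable_I01 : @measurable _ (measurableTypeR R) (@I01 R).
Proof. by rewrite I01E. Qed.
Hint Resolve measurable_I01 : core.

Lemma floor_atom n k x : atom n k x -> Num.floor (2 ^+ n * x) = k%:Z.
Proof.
move=> /atomP H; apply: floor_def.
by rewrite -[(k%:Z + 1)%R]/(k%:Z + 1%:Z) -PoszD addn1 -!pmulrn.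
Qed.

Lemma dyadic_atomE n k x : atom n k x -> dyadic_atom n x = atom n k.
Proof. by move=> /floor_atom H; rewrite /dyadic_atom H /atom -pmulrn natr1. Qed.

Lemma condexp_atom n k x g : atom n k x -> condexp n g x = average n k g.
Proof. by move=> /dyadic_atomE H; rewrite /condexp H. Qed.

Lemma atom_cover n x : I01 x -> exists2 k, (k < 2 ^ n)%N & atom n k x.
Proof.
rewrite /I01 /= in_itv/= => /andP[x0 x1].
have p0 : 0 < 2 ^+ n :> R by rewrite exprn_gt0.
have y0 : 0 <= 2 ^+ n * x by rewrite mulr_ge0// ltW.
exists (Num.truncn (2 ^+ n * x)); last by apply/atomP/truncn_itv.
have /andP[H1 _] := truncn_itv y0.
rewrite -(ltr_nat R) natrX; apply: le_lt_trans H1 _.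
by rewrite -[ltRHS]mulr1 ltr_pM2l.
Qed.

Lemma atom_sub n i k : atom (n + i) k `<=` atom n (k %/ 2 ^ i).
Proof.
move=> x /atomP; rewrite exprD => /andP[H1 H2]; apply/atomP.
have p0 : 0 < 2 ^+ i :> R by rewrite exprn_gt0.
have E : (k = k %/ 2 ^ i * 2 ^ i + k %% 2 ^ i)%N by exact: divn_eq.
have L : (k %% 2 ^ i < 2 ^ i)%N by rewrite ltn_mod expn_gt0.
apply/andP; split.
  rewrite -(ler_pM2r p0) mulrAC; apply: le_trans H1.
  by rewrite -natrX -natrM ler_nat {2}E leq_addr.
rewrite -(ltr_pM2r p0) mulrAC; apply: lt_le_trans H2 _.
rewrite -natrX -natrM ler_nat {1}E mulSn; lia.
Qed.

Lemma atom_I01 n k : (k < 2 ^ n)%N -> atom n k `<=` @I01 R.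
Proof. by move=> k2; rewrite I01E; have := @atom_sub 0 n k; rewrite add0n divn_small. Qed.

Lemma atom_split n k : atom n k = atom n.+1 k.*2 `|` atom n.+1 k.*2.+1.
Proof.
apply/seteqP; split => x.
  move=> /atomP/andP[H1 H2].
  have E : 2 ^+ n.+1 * x = 2 * (2 ^+ n * x) by rewrite exprS mulrA.
  have [Hx|Hx] := ltP (2 ^+ n.+1 * x) k.*2.+1%:R; [left|right]; apply/atomP.
    by rewrite Hx andbT E -muln2 natrM mulrC ler_pM2l.
  rewrite Hx/= E -doubleS -muln2 natrM mulrC; by rewrite ltr_pM2r.
by move=> []; [have := @atom_sub n 1 k.*2 x|have := @atom_sub n 1 k.*2.+1 x];
  rewrite addn1 expn1 divn2 ?doubleK//= uphalf_double.
Qed.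

Lemma atom_disj n k : [disjoint atom n.+1 k.*2 & atom n.+1 k.*2.+1].
Proof.
rewrite disj_set2E; apply/eqP/seteqP; split=> // x [] /atomP/andP[_ +] /atomP/andP[].
by move=> /lt_le_trans H /H; rewrite ltxx.
Qed.

Lemma average_split n k g : mu.-integrable (atom n k) (EFin \o g) ->
  average n k g = (average n.+1 k.*2 g + average n.+1 k.*2.+1 g) / 2.
Proof.
move=> gi; have gi' := gi; rewrite atom_split in gi'.
rewrite /average atom_split.
rewrite (Rintegral_setU (measurable_atom _ _) (measurable_atom _ _) gi' (atom_disj n k)).
by rewrite exprS; field.
Qed.

Lemma rad_atom n k x : atom n.+1 k x -> rad n x = (-1) ^+ odd k.
Proof.
move=> xk; have := @atom_sub n 1 k x; rewrite addn1 expn1 divn2 => /(_ xk).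
move=> /floor_atom xn; rewrite /rad /rademacher /frac_part xn.
move: xk => /atomP; rewrite exprS -mulrA; set y := 2 ^+ n * x.
have -> : k%:R = (odd k)%:R + 2 * k./2%:R :> R.
  by rewrite -{1}(odd_double_half k) natrD -muln2 natrM mulrC.
have -> : k.+1%:R = (odd k)%:R + 2 * k./2%:R + 1 :> R.
  by rewrite -[k.+1%:R]natr1 -{1}(odd_double_half k) natrD -muln2 natrM (mulrC 2).
rewrite -pmulrn ltrBlDr -(ltr_pM2l (ltr0n R 2)) mulrDr mulfV ?pnatr_eq0//.
case: (odd k) => /= /andP[H2 H3]; rewrite ?expr1 ?expr0.
  by rewrite ltNge H2.
by move: H3; rewrite add0r addrC => ->.
Qed.

Lemma norm_rad n x : `|rad n x| = 1.
Proof. by rewrite /rad /rademacher; case: ifP; rewrite ?normrN normr1. Qed.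

Lemma rad_sqr n x : rad n x * rad n x = 1.
Proof. by rewrite /rad /rademacher; case: ifP; rewrite ?mulrNN mulr1. Qed.

Lemma measurable_rad n (D : set R) : measurable D -> measurable_fun D (rad n).
Proof.
move=> mD; apply: (@measurable_funS _ _ _ _ setT) => //.
have mf : measurable_fun setT (fun x : R => (Num.floor (2 ^+ n * x))%:~R : R).
  apply: nondecreasing_measurable => // x y xy.
  rewrite ler_int le_floor// ler_pM2l// exprn_gt0//.
have mm : measurable_fun setT (fun x : R => frac_part (2 ^+ n * x)).
  by apply: measurable_funB => //; exact: mulrl_measurable.
rewrite /rad /rademacher.
by apply: measurable_fun_ifT => //; apply: measurable_fun_ltr.
Qed.

Lemma integrable_rad f n : mu.-integrable (@I01 R) (EFin \o f) ->
  mu.-integrable (@I01 R) (EFin \o (fun x => f x * rad n x)).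
Proof.
move=> fi; apply: (le_integrable _ _ _ fi) => //.
  apply/measurable_EFinP/measurable_funM; last exact: measurable_rad.
  by have /integrableP[/measurable_EFinP] := fi.
by move=> x _ /=; rewrite normrM norm_rad mulr1.
Qed.

Lemma integrable_atom f n k : (k < 2 ^ n)%N -> mu.-integrable (@I01 R) (EFin \o f) ->
  mu.-integrable (atom n k) (EFin \o f).
Proof. by move=> k2; apply: integrableS => //; exact: atom_I01. Qed.

Lemma eq_average n k g f : (forall x, atom n k x -> g x = f x) ->
  average n k g = average n k f.
Proof. by move=> gf; congr (_ * _); apply: eq_Rintegral => x /set_mem; exact: gf. Qed.

Lemma averageZ n k g (a : R) : mu.-integrable (atom n k) (EFin \o g) ->
  average n k (fun x => g x * a) = average n k g * a.
Proof. by move=> gi; rewrite /average RintegralZr// mulrA. Qed.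

Lemma condexp0 g x : I01 x -> condexp 0 g x = Rintegral mu (@I01 R) g.
Proof. by rewrite I01E => /condexp_atom ->; rewrite /average expr0 mul1r. Qed.

(** [rad n] is 1 on the left half of an atom and -1 on the right half, so the increment is plus or
    minus the half-difference of the two averages. *)
Lemma condexpS n g x : I01 x -> mu.-integrable (@I01 R) (EFin \o g) ->
  condexp n.+1 g x = condexp n g x + rad n x * condexp n (fun y => g y * rad n y) x.
Proof.
move=> Ix gi; have [k k2 kx] := atom_cover n Ix.
have l2 : (k.*2 < 2 ^ n.+1)%N by rewrite expnS; lia.
have r2 : (k.*2.+1 < 2 ^ n.+1)%N by rewrite expnS; lia.
have gri := integrable_rad n gi.
rewrite !(condexp_atom _ kx) (average_split (integrable_atom k2 gi)).
rewrite (average_split (integrable_atom k2 gri)).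
rewrite (@eq_average _ k.*2 (fun y => g y * rad n y) (fun y => g y * 1)); last first.
  by move=> y /rad_atom ->; rewrite odd_double expr0.
rewrite (@eq_average _ k.*2.+1 (fun y => g y * rad n y) (fun y => g y * -1)); last first.
  by move=> y /rad_atom ->; rewrite /= odd_double expr1.
rewrite !averageZ; try exact: integrable_atom.
move: kx; rewrite atom_split => -[] kx; rewrite (condexp_atom _ kx) (rad_atom kx)/=.
  by rewrite odd_double expr0; field.
by rewrite odd_double expr1; field.
Qed.

Lemma condexp_rad n i g x : (i < n)%N -> I01 x -> mu.-integrable (@I01 R) (EFin \o g) ->
  condexp n (fun y => g y * rad i y) x = rad i x * condexp n g x.
Proof.
move=> i_n Ix gi; have [k k2 kx] := atom_cover n Ix.
have sub y : atom n k y -> rad i y = (-1) ^+ odd (k %/ 2 ^ (n - i.+1)).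
  move=> ky; apply: rad_atom; apply: atom_sub.
  by rewrite subnKC.
rewrite !(condexp_atom _ kx) (@eq_average _ _ _
  (fun y => g y * (-1) ^+ odd (k %/ 2 ^ (n - i.+1)))).
  by rewrite averageZ ?(sub _ kx) 1?mulrC//; exact: integrable_atom.
by move=> y /sub ->.
Qed.

(** * Binary digits, Walsh functions and their partial sums *)

Definition bit (n k : nat) : bool := odd (n %/ 2 ^ k).

Lemma bit_small n k : (n < 2 ^ k)%N -> bit n k = false.
Proof. by move=> nk; rewrite /bit divn_small. Qed.

Lemma bit_top n m : (n < 2 ^ m)%N -> bit (2 ^ m + n) m.
Proof. by move=> nm; rewrite /bit divnDl ?dvdnn// divnn expn_gt0/= divn_small. Qed.

Lemma bit_low n m k : (k < m)%N -> bit (2 ^ m + n) k = bit n k.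
Proof.
move=> km; rewrite /bit divnDl ?dvdn_exp2l 1?ltnW// -expnB// 1?ltnW// oddD.
by rewrite oddX subn_eq0 leqNgt km.
Qed.

Lemma walshE n m x : (n < 2 ^ m)%N ->
  walsh n x = \prod_(k < m) (if bit n k then rad k x else 1).
Proof.
have ext i j : (i <= j)%N -> (n < 2 ^ i)%N ->
    \prod_(k < i) (if bit n k then rad k x else 1) =
    \prod_(k < j) (if bit n k then rad k x else 1).
  move=> ij ni; rewrite -!(big_mkord xpredT (fun k => if bit n k then rad k x else 1)).
  rewrite [RHS](big_cat_nat (n := i))//= [X in _ * X]big1_seq ?mulr1// => k /andP[_].
  rewrite mem_index_iota => /andP[ik _]; rewrite bit_small//.
  by apply: leq_trans ni _; rewrite leq_exp2l.
move=> nm; have nn : (n < 2 ^ n)%N by exact: ltn_expl.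
have [nm'|/ltnW mn] := leqP n m; first exact: ext.
by rewrite /walsh -(ext _ _ mn nm).
Qed.

Lemma walsh0 x : walsh 0 x = 1.
Proof. by rewrite /walsh big_ord0. Qed.

Lemma walsh_top n m x : (n < 2 ^ m)%N -> walsh (2 ^ m + n) x = rad m x * walsh n x.
Proof.
move=> nm; rewrite (@walshE _ m.+1); last by rewrite expnS; lia.
rewrite big_ord_recr/= bit_top// mulrC (@walshE n m)//; congr (_ * _).
by apply: eq_bigr => k _; rewrite bit_low.
Qed.

Lemma walsh_norm n x : `|walsh n x| = 1.
Proof.
rewrite /walsh normr_prod big1// => k _.
by case: ifP => _; rewrite ?norm_rad ?normr1.
Qed.

Lemma rad_prodS (b : nat -> bool) m f : (fun y => f y *
    \prod_(k < m.+1) (if b k then rad k y else 1)) =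
  fun y => (f y * \prod_(k < m) (if b k then rad k y else 1)) *
    (if b m then rad m y else 1).
Proof. by apply/funext => y; rewrite big_ord_recr/= mulrA. Qed.

Lemma fun_mulr1 f : (fun y => f y * 1) = f.
Proof. by apply/funext => y; rewrite mulr1. Qed.

Lemma rad_prod0 (b : nat -> bool) f :
  (fun y => f y * \prod_(k < 0) (if b k then rad k y else 1)) = f.
Proof. by apply/funext => y; rewrite big_ord0 mulr1. Qed.

Lemma integrable_rad_prod (b : nat -> bool) m f :
  mu.-integrable (@I01 R) (EFin \o f) -> mu.-integrable (@I01 R)
    (EFin \o (fun x => f x * \prod_(k < m) (if b k then rad k x else 1))).
Proof.
move=> fi; elim: m => [|m IH]; first by rewrite rad_prod0.
rewrite rad_prodS; case: (b m); first exact: integrable_rad.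
by rewrite fun_mulr1.
Qed.

Lemma integrable_walsh f n : mu.-integrable (@I01 R) (EFin \o f) ->
  mu.-integrable (@I01 R) (EFin \o (fun x => f x * walsh n x)).
Proof. exact: (@integrable_rad_prod (bit n) n). Qed.

Lemma condexp_rad_prod (b : nat -> bool) m n f x : (m <= n)%N -> I01 x ->
  mu.-integrable (@I01 R) (EFin \o f) ->
  condexp n (fun y => f y * \prod_(k < m) (if b k then rad k y else 1)) x =
  \prod_(k < m) (if b k then rad k x else 1) * condexp n f x.
Proof.
move=> + Ix fi; elim: m => [|m IH] mn; first by rewrite rad_prod0 big_ord0 mul1r.
rewrite rad_prodS [in RHS]big_ord_recr/=; case: (b m).
  rewrite condexp_rad//; last exact: integrable_rad_prod.
  by rewrite (IH (ltnW mn)); ring.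
by rewrite fun_mulr1 mulr1 (IH (ltnW mn)).
Qed.

(** The indices from 2^m on share the factor [rad m]. The case n = 2^m is included because it
    doubles a block in [partial_sum_pow2]. *)
Lemma partial_sum_split n m f x : (n <= 2 ^ m)%N ->
  walsh_partial_sum (2 ^ m + n) f x = walsh_partial_sum (2 ^ m) f x +
    rad m x * walsh_partial_sum n (fun y => f y * rad m y) x.
Proof.
move=> nm; rewrite /walsh_partial_sum big_split_ord/=; congr (_ + _).
rewrite mulr_sumr; apply: eq_bigr => k _ /=.
have km : (k < 2 ^ m)%N by exact: leq_trans (ltn_ord k) nm.
rewrite walsh_top// mulrCA; congr (_ * (_ * _)).
by apply: eq_Rintegral => y _; rewrite walsh_top// mulrA.
Qed.

Lemma partial_sum_pow2 m f x : I01 x -> mu.-integrable (@I01 R) (EFin \o f) ->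
  walsh_partial_sum (2 ^ m) f x = condexp m f x.
Proof.
move=> Ix; elim: m f => [|m IH] f fi.
  rewrite /walsh_partial_sum big_ord1 walsh0 mulr1 condexp0//.
  by apply: eq_Rintegral => y _; rewrite walsh0 mulr1.
rewrite expnS mul2n -addnn partial_sum_split// !IH//; first by rewrite condexpS.
exact: integrable_rad.
Qed.

(** Induction on the digits. For n = 2^m + i, the tail is a partial sum of length [i] of f * rad m,
    and (f * rad m) * w_i = f * w_n keeps the same martingale. *)
Lemma walsh_partial_sum_transform n m f x : (n < 2 ^ m)%N -> I01 x ->
  mu.-integrable (@I01 R) (EFin \o f) ->
  walsh_partial_sum n f x = walsh n x * \sum_(j < m) (bit n j)%:R *
    (condexp j.+1 (fun y => f y * walsh n y) x -
     condexp j (fun y => f y * walsh n y) x).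
Proof.
move=> + Ix; elim: m n f => [|m IH] n f nm fi.
  have -> : n = 0%N by move: nm; rewrite expn0; lia.
  by rewrite /walsh_partial_sum !big_ord0 mulr0.
rewrite big_ord_recr/=; have [nm'|mn] := ltnP n (2 ^ m).
  by rewrite bit_small// mul0r addr0; exact: IH.
have [i nE im] : exists2 i, n = (2 ^ m + i)%N & (i < 2 ^ m)%N.
  by exists (n - 2 ^ m)%N; move: nm; rewrite ?expnS; lia.
subst n; rewrite bit_top// mul1r partial_sum_split 1?ltnW// partial_sum_pow2//.
have fri := integrable_rad m fi.
rewrite (IH i (fun y => f y * rad m y))//.
have -> : (fun y => f y * walsh (2 ^ m + i) y) =
    (fun y => (f y * rad m y) * walsh i y).
  by apply/funext => y; rewrite walsh_top// mulrA.
set g := fun y => (f y * rad m y) * walsh i y.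
rewrite walsh_top// mulrA mulrDr addrC; congr (_ + _).
  by congr (_ * _); apply: eq_bigr => j _; rewrite bit_low.
have gi : mu.-integrable (@I01 R) (EFin \o g) by exact: integrable_walsh.
(* The top increment must reproduce the block E_m f: it is [rad m] times E_m of g * rad m = f * w_i,
   and w_i is constant on atoms of generation [m]. *)
rewrite condexpS// addrAC subrr add0r.
have -> : (fun y => g y * rad m y) = (fun y => f y * walsh i y).
  apply/funext => y; rewrite /g -[RHS]mulr1 -(rad_sqr m y); ring.
have -> : condexp m (fun y => f y * walsh i y) x = walsh i x * condexp m f x.
  rewrite (_ : (fun y => _) = (fun y => f y *
     \prod_(k < m) (if bit i k then rad k y else 1))); last first.
    by apply/funext => y; rewrite (walshE y im).
  rewrite (walshE x im).
  exact: condexp_rad_prod.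
have -> : rad m x * walsh i x * (rad m x * (walsh i x * condexp m f x)) =
  (rad m x * rad m x) * (walsh i x * walsh i x) * condexp m f x by ring.
have -> : walsh i x * walsh i x = 1.
  by rewrite -expr2 -real_normK ?num_real// walsh_norm expr1n.
by rewrite rad_sqr !mul1r.
Qed.

End Dyadic.

(** * From the tree to the Musielak-Orlicz space *)

(* No measurability is assumed: the integral of a nonnegative function is the
   supremum over the simple functions below it. *)
Lemma ge0_le_integral_lower d (T : measurableType d) (R : realType)
    (m : {measure set T -> \bar R}) (D : set T) (f1 f2 : T -> \bar R) :
  (forall x, D x -> 0 <= f1 x)%E -> (forall x, D x -> f1 x <= f2 x)%E ->
  (\int[m]_(x in D) f1 x <= \int[m]_(x in D) f2 x)%E.
Proof.
move=> f10 f12; rewrite !ge0_integralE//; last first.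
  by move=> x Dx; apply: le_trans (f10 x Dx) (f12 x Dx).
apply: ereal_sup_le => _ [h /= hf1 <-]; exists h => //= x.
by apply: le_trans (hf1 x) _; exact: lee_restrict.
Qed.

Section Assembly.
Variable R : realType.
Local Notation mu := (@lebesgue_measure R).
Implicit Types (f g u : R -> R) (x y : R).

Let mI : @measurable _ (measurableTypeR R) (@I01 R) := @measurable_I01 R.
Let mA n k : @measurable _ (measurableTypeR R) (@atom R n k) := @measurable_atom R n k.

(** Atoms have positive measure. As [condexp] is constant on them, one good point turns an
    almost-everywhere A_q bound into a bound on the atom. *)
Lemma ae_atom (P : R -> Prop) n k : {ae mu, forall x, P x} ->
  exists2 x, @atom R n k x & P x.
Proof.
move=> aeP; apply: contrapT => H.
have sub : @atom R n k `<=` ~` [set x | P x].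
  by move=> x kx Px; apply: H; exists x.
have /(negligibleP mu (mA n k)) : mu.-negligible (@atom R n k).
  by apply: negligibleS; [exact: sub|exact: aeP].
move=> M0; have := mu_atom R n k; rewrite [LHS]M0 => -[] /esym/eqP.
by rewrite invr_eq0 expf_eq0 pnatr_eq0 andbF.
Qed.

Lemma average_cst n k (a : R) : average n k (fun=> a) = a.
Proof.
have p0 : 2 ^+ n != 0 :> R by rewrite expf_neq0// pnatr_eq0.
rewrite /average Rintegral_cst// [X in _ * (_ * fine X)](mu_atom R n k)/=.
by rewrite mulrCA mulfV// mulr1.
Qed.

Lemma le_average n k g f : mu.-integrable (atom n k) (EFin \o g) ->
  mu.-integrable (atom n k) (EFin \o f) -> (forall x, atom n k x -> g x <= f x) ->
  average n k g <= average n k f.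
Proof.
move=> gi fi gf; rewrite /average ler_wpM2l ?exprn_ge0//.
exact: le_Rintegral.
Qed.

Lemma average_ge0 n k g : (forall x, atom n k x -> 0 <= g x) -> 0 <= average n k g.
Proof. by move=> g0; rewrite mulr_ge0 ?exprn_ge0// Rintegral_ge0. Qed.

Lemma averageD n k g f : mu.-integrable (atom n k) (EFin \o g) ->
  mu.-integrable (atom n k) (EFin \o f) ->
  average n k (fun x => g x + f x) = average n k g + average n k f.
Proof. by move=> gi fi; rewrite /average RintegralD// mulrDr. Qed.

Lemma integrable_atom_cst n k (a : R) : mu.-integrable (atom n k) (EFin \o (fun=> a)).
Proof.
apply: measurable_bounded_integrable => //.
  by rewrite [X in (X < _)%E](mu_atom R n k) ltry.
exists `|a|; split => // M aM y _ /=; exact: ltW.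
Qed.

Lemma integrable_scale (D : set R) g (a : R) :
  @measurable _ (measurableTypeR R) D -> mu.-integrable D (EFin \o g) ->
  mu.-integrable D (EFin \o (fun x => g x * a)).
Proof. by move=> mD gi; exact: (integrableZr mD a gi). Qed.

Lemma integrable_add (D : set R) g f :
  @measurable _ (measurableTypeR R) D -> mu.-integrable D (EFin \o g) ->
  mu.-integrable D (EFin \o f) -> mu.-integrable D (EFin \o (fun x => g x + f x)).
Proof. by move=> mD gi fi; exact: (integrableD mD gi fi). Qed.

Lemma average_gt0 n k g : mu.-integrable (atom n k) (EFin \o g) ->
  (forall x, atom n k x -> 0 < g x) -> 0 < average n k g.
Proof.
move=> gi g0; rewrite lt_neqAle average_ge0 ?andbT; last first.
  by move=> x /g0/ltW.
have p0 : 2 ^+ n != 0 :> R by rewrite expf_neq0// pnatr_eq0.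
apply/negP => /eqP /esym /eqP; rewrite mulf_eq0 (negbTE p0)/= => /eqP I0.
have : (\int[mu]_(x in atom n k) `|(EFin \o g) x|)%E = 0%E.
  rewrite -[RHS]/(0%:E) -I0 /Rintegral fineK; last exact: integrable_fin_num.
  by apply: eq_integral => x /set_mem /g0 gx /=; rewrite gtr0_norm.
have mg : measurable_fun (atom n k) (EFin \o g) by case/integrableP : gi.
move=> /(ae_eq_integral_abs mu (mA n k) mg) /(@ae_atom _ n k)[x kx /(_ kx)/= [gx0]].
by have := g0 x kx; rewrite gx0 ltxx.
Qed.

(** * The A_q condition on atoms *)

Variable phi : R -> R -> R.
Hypothesis mo : MO_function phi.

Definition dual_weight (q t : R) : R -> R := fun y => phi y t `^ (- (q - 1)^-1).

Definition Aq_atoms (q K : R) : Prop := forall n k t, (k < 2 ^ n)%N -> 0 < t ->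
  mu.-integrable (atom n k) (EFin \o dual_weight q t) /\
  average n k (phi^~ t) * average n k (dual_weight q t) `^ (q - 1) <= K.

Lemma phi_gt0 x t : I01 x -> 0 < t -> 0 < phi x t.
Proof. by move=> Ix t0; have [_ _ _ [_ H _]] := mo; exact: H. Qed.

Lemma phi_ge0 x t : I01 x -> 0 <= t -> 0 <= phi x t.
Proof.
by move=> Ix t0; have [H H0 _ _] := mo; rewrite -(H0 x Ix); exact: H.
Qed.

Lemma phi_le x s t : I01 x -> 0 <= s -> s <= t -> phi x s <= phi x t.
Proof. by have [H _ _ _] := mo; exact: H. Qed.

Lemma phi_integrable t : 0 <= t -> mu.-integrable (@I01 R) (EFin \o phi^~ t).
Proof. by have [_ _ _ [_ _ H]] := mo; exact: H. Qed.

Lemma phi_measurable t : 0 <= t -> measurable_fun (@I01 R) (phi^~ t).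
Proof. by have [_ _ _ [H _ _]] := mo; exact: H. Qed.

Lemma Aq_atoms_weaken q K K' : K <= K' -> Aq_atoms q K -> Aq_atoms q K'.
Proof.
by move=> KK H n k t k2 t0; have [H1 /le_trans H2] := H n k t k2 t0; split; [|exact: H2].
Qed.

Lemma Aq_atoms_Aq q : Aq phi q -> exists2 K, 1 <= K & Aq_atoms q K.
Proof.
move=> [K H]; exists (Num.max K 1); first by rewrite le_max lexx orbT.
apply: (@Aq_atoms_weaken q K); first by rewrite le_max lexx.
move=> n k t k2 t0; have [x kx /(_ (atom_I01 k2 kx) n t t0)] := ae_atom n k H.
by rewrite !(condexp_atom _ kx) (dyadic_atomE kx).
Qed.

(** A_1 gives phi >= W / K almost everywhere on the atom, so the dual weight is at most c =
    (W/K)^(-1/(q-1)), and W * c^(q-1) = K. *)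
Lemma Aq_atoms_A1 q : 1 < q -> A1 phi -> exists2 K, 1 <= K & Aq_atoms q K.
Proof.
move=> q1 [K H]; exists (Num.max K 1); first by rewrite le_max lexx orbT.
apply: (@Aq_atoms_weaken q K); first by rewrite le_max lexx.
move=> n k t k2 t0.
have q0 : 0 < q - 1 by rewrite subr_gt0.
have pi := integrable_atom k2 (phi_integrable (ltW t0)).
have pp y : atom n k y -> 0 < phi y t by move=> ky; apply: phi_gt0 t0; exact: atom_I01 ky.
have W0 : 0 < average n k (phi^~ t) by exact: average_gt0.
set W := average n k (phi^~ t) in W0 *.
have K0 : 0 < K.
  have [x kx /(_ (atom_I01 k2 kx) n t t0)] := ae_atom n k H.
  rewrite (condexp_atom _ kx) -/W => /(lt_le_trans W0).
  by rewrite pmulr_lgt0// pp.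
pose c := (W / K) `^ (- (q - 1)^-1).
have c0 : 0 < c by rewrite powR_gt0// divr_gt0.
have sc : {ae mu, forall y, atom n k y -> ((dual_weight q t y)%:E <= c%:E)%E}.
  apply: negligibleS; last exact: H.
  apply: subsetC => y Hy ky; have := Hy (atom_I01 k2 ky) n t t0.
  rewrite (condexp_atom _ ky) -/W lee_fin => Wk.
  rewrite /c /dual_weight !powRN lef_pV2 ?posrE ?powR_gt0 ?divr_gt0// ?pp//.
  rewrite ge0_ler_powR ?nnegrE ?invr_ge0 ?divr_ge0 ?(ltW q0) ?(ltW W0) ?(ltW K0) ?(ltW (pp _ ky))//.
  by rewrite ler_pdivrMr// mulrC.
have ms : measurable_fun (atom n k) (dual_weight q t).
  apply: (@measurable_funS _ _ _ _ (@I01 R)) => //; first exact: atom_I01.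
  apply: (measurableT_comp (measurable_powR _)).
  exact: phi_measurable (ltW t0).
have s0 y : 0 <= dual_weight q t y by exact: powR_ge0.
have si : (\int[mu]_(y in atom n k) (dual_weight q t y)%:E <= (c * 2 ^- n)%:E)%E.
  apply: (@le_trans _ _ (\int[mu]_(y in atom n k) (cst c%:E y))%E).
    apply: ae_ge0_le_integral => //.
    - by move=> y _; rewrite lee_fin.
    - exact/measurable_EFinP.
    - by move=> y _; rewrite lee_fin ltW.
  by rewrite integral_cst//= [X in (_ * X)%E](mu_atom R n k) EFinM.
have sint : mu.-integrable (atom n k) (EFin \o dual_weight q t).
  apply/integrableP; split; first exact/measurable_EFinP.
  apply: le_lt_trans (ltry (c * 2 ^- n)); apply: le_trans si.
  rewrite le_eqVlt; apply/orP; left; apply/eqP; apply: eq_integral => y _ /=.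
  by rewrite ger0_norm.
split => //.
have Sc : average n k (dual_weight q t) <= c.
  have p0 : 0 < 2 ^+ n :> R by rewrite exprn_gt0.
  rewrite /average mulrC -ler_pdivlMr// -lee_fin /Rintegral fineK//.
  exact: integrable_fin_num.
apply: (@le_trans _ _ (W * c `^ (q - 1))).
  rewrite ler_wpM2l ?(ltW W0)// ge0_ler_powR ?nnegrE ?(ltW q0) ?(ltW c0)//.
  by apply: average_ge0 => y _.
rewrite /c -powRrM mulNr mulVf ?gt_eqF// powR_inv1 ?divr_ge0 ?(ltW W0) ?(ltW K0)//.
by rewrite invf_div mulrCA mulfV ?gt_eqF// mulr1.
Qed.

Lemma q_index_lt p : A_infty phi -> q_index phi < p ->
  exists q K, [/\ 1 < q, q < p, 1 <= K & Aq_atoms q K].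
Proof.
move=> [q0 [q01 Aq0]] /inf_lt.
have ne : [set q : R | 1 <= q /\ A_cond phi q] !=set0 by exists q0.
move=> /(_ ne)[q [q1]]; rewrite /A_cond; case: ifP => [/eqP qE A1q qp|/negbT qn Aqq qp].
  (* An exponent of exactly 1 is replaced by the midpoint of 1 and [p], since the tree needs
     [1 < q < p]. *)
  have [K K1 HK] := @Aq_atoms_A1 ((1 + p) / 2) ltac:(lra) A1q.
  by exists ((1 + p) / 2), K; split => //; lra.
have [K K1 HK] := Aq_atoms_Aq Aqq.
by exists q, K; split => //; rewrite lt_neqAle eq_sym qn.
Qed.

(** * The tree of averages of a function *)

Variables (q p p' C K : R).
Hypotheses (q1 : 1 < q) (qp : q < p) (C1 : 1 <= C) (K1 : 1 <= K).
Hypothesis gphi : forall x, I01 x -> growth C p p' (phi x).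
Hypothesis Aqphi : Aq_atoms q K.

Lemma dual_integrable n k t : (k < 2 ^ n)%N -> 0 < t ->
  mu.-integrable (atom n k) (EFin \o dual_weight q t).
Proof. by move=> k2 t0; have [] := Aqphi k2 t0. Qed.

Lemma dual_integrable_I01 t : 0 < t -> mu.-integrable (@I01 R) (EFin \o dual_weight q t).
Proof. by move=> t0; rewrite I01E; exact: dual_integrable. Qed.

Definition atom_leaf g (n k : nat) : leaf R :=
  MkLeaf (average n k g) (average n k (fun x => `|g x|))
    (fun t => average n k (phi^~ t)) (fun t => average n k (dual_weight q t)).

Fixpoint atom_tree (c : nat -> R) g (m n k : nat) : tree R :=
  match m with
  | 0 => Leaf (atom_leaf g n k)
  | m'.+1 => Node (c n) (atom_tree c g m' n.+1 k.*2) (atom_tree c g m' n.+1 k.*2.+1)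
  end.

Lemma child_lt n k : (k < 2 ^ n)%N -> (k.*2 < 2 ^ n.+1)%N /\ (k.*2.+1 < 2 ^ n.+1)%N.
Proof. by rewrite expnS => k2; split; lia. Qed.

Lemma av_atom_tree (F : leaf R -> R) h c g m n k :
  (forall i j, F (atom_leaf g i j) = average i j h) ->
  mu.-integrable (@I01 R) (EFin \o h) -> (k < 2 ^ n)%N ->
  av F (atom_tree c g m n k) = average n k h.
Proof.
move=> HF hi; elim: m n k => [|m IH] n k k2 /=; first exact: HF.
have [k2l k2r] := child_lt k2.
by rewrite !IH// -average_split//; exact: integrable_atom.
Qed.

(** One-sided form, needed for [lw l (lh l)], which is not the average of a fixed function. *)
Lemma av_atom_tree_le (F : leaf R -> R) h c g m n k :
  (forall i j, (j < 2 ^ i)%N -> F (atom_leaf g i j) <= average i j h) ->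
  mu.-integrable (@I01 R) (EFin \o h) -> (k < 2 ^ n)%N ->
  av F (atom_tree c g m n k) <= average n k h.
Proof.
move=> HF hi; elim: m n k => [|m IH] n k k2 /=; first exact: HF.
have [k2l k2r] := child_lt k2.
rewrite (average_split (integrable_atom k2 hi)).
by have := IH n.+1 k.*2 k2l; have := IH n.+1 k.*2.+1 k2r; lra.
Qed.

Lemma dual_test n k t a : (k < 2 ^ n)%N -> 0 < t -> 0 < a ->
  1 <= a * average n k (dual_weight q t) + a `^ (1 - q) * average n k (phi^~ t).
Proof.
move=> k2 t0 a0.
have pi := integrable_atom k2 (phi_integrable (ltW t0)).
have si := dual_integrable k2 t0.
rewrite mulrC (mulrC (a `^ _)) -!averageZ// -averageD; try exact: integrable_scale.
rewrite -{1}(average_cst n k 1); apply: le_average.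
- exact: integrable_atom_cst.
- apply: integrable_add => //; exact: integrable_scale.
- move=> x kx; rewrite mulrC (mulrC (phi _ _)).
  by apply: dual_weight_test => //; apply: phi_gt0 => //; exact: atom_I01 kx.
Qed.

Lemma average_growth n k : (k < 2 ^ n)%N -> growth C p p' (fun t => average n k (phi^~ t)).
Proof.
move=> k2; have C0 : 0 <= C by exact: le_trans C1.
have pi t : 0 <= t -> mu.-integrable (atom n k) (EFin \o phi^~ t).
  by move=> t0; exact: integrable_atom (phi_integrable t0).
have G x : atom n k x -> growth C p p' (phi x) by move/(atom_I01 k2); exact: gphi.
split.
- rewrite -[RHS](average_cst n k 0); apply: eq_average => x kx.
  by have [] := G x kx.
- move=> s t s0 st; apply: le_average; [exact: pi|apply: pi; exact: le_trans st|].
  by move=> x kx; have [_ H _ _] := G x kx; exact: H.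
- move=> s t /andP[s0 s1] t0; rewrite /= [leRHS]mulrC -averageZ; last exact: pi.
  apply: le_average; [apply: pi; exact: mulr_ge0 (ltW s0) t0|apply: integrable_scale => //; exact: pi|].
  by move=> x kx; have [_ _ H _] := G x kx; rewrite (mulrC (phi _ _)); apply: H => //; rewrite s0.
- move=> s t s1 t0; have s0 : 0 <= s by exact: le_trans s1.
  rewrite /= [leRHS]mulrC -averageZ; last exact: pi.
  apply: le_average; [apply: pi; exact: mulr_ge0|apply: integrable_scale => //; exact: pi|].
  by move=> x kx; have [_ _ _ H] := G x kx; rewrite (mulrC (phi _ _)); exact: H.
Qed.

Lemma atom_leaf_ok g n k : mu.-integrable (@I01 R) (EFin \o g) -> (k < 2 ^ n)%N ->
  leaf_ok q p p' C (atom_leaf g n k).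
Proof.
move=> gi k2; split => /=.
- rewrite /average normrM ger0_norm ?exprn_ge0// ler_wpM2l ?exprn_ge0//.
  by apply: le_normr_Rintegral => //; exact: integrable_atom.
- exact: average_growth.
- by move=> s s0; apply: average_ge0 => x _; exact: powR_ge0.
- by move=> s a s0 a0; exact: dual_test.
Qed.

Lemma atom_tree_ok c g m n k : (forall i, `|c i| <= 1) ->
  mu.-integrable (@I01 R) (EFin \o g) -> (k < 2 ^ n)%N ->
  tree_ok q p p' C K (atom_tree c g m n k).
Proof.
move=> c1 gi; have node i j k' s : (k' < 2 ^ j)%N -> 0 < s ->
    av (@lw R ^~ s) (atom_tree c g i j k') *
      av (@ls R ^~ s) (atom_tree c g i j k') `^ (q - 1) <= K.
  move=> k2 s0; rewrite (@av_atom_tree _ (phi^~ s))//; last exact: phi_integrable (ltW s0).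
  rewrite (@av_atom_tree _ (dual_weight q s))//; last exact: dual_integrable_I01.
  by have [_] := Aqphi k2 s0.
elim: m n k => [|m IH] n k k2.
  by split; [move=> s; exact: (node 0%N)|exact: atom_leaf_ok].
split; first by move=> s; exact: (node m.+1).
by have [k2l k2r] := child_lt k2; split => //; exact: IH.
Qed.

(** On a leaf the transform is a constant [d], so the integrand is [phi y] at a fixed argument;
    measurability is carried along because splitting the integral over the two halves requires
    it. *)
Lemma atom_tree_tmod (c : nat -> R) g m n k (d : R) :
  mu.-integrable (@I01 R) (EFin \o g) -> (k < 2 ^ n)%N ->
  (\int[mu]_(y in atom n k) (phi y `|d + \sum_(i < m) c (n + i)%N *
      (condexp (n + i).+1 g y - condexp (n + i) g y)|)%:E =
   (2 ^- n * tmod d (atom_tree c g m n k))%:E)%E /\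
  measurable_fun (atom n k) (fun y => phi y `|d + \sum_(i < m) c (n + i)%N *
      (condexp (n + i).+1 g y - condexp (n + i) g y)|).
Proof.
move=> gi; elim: m n k d => [|m IH] n k d k2.
  have E y : phi y `|d + \sum_(i < 0) c (n + i)%N *
      (condexp (n + i).+1 g y - condexp (n + i) g y)| = phi y `|d|.
    by rewrite big_ord0 addr0.
  split; last first.
    apply: (@eq_measurable_fun _ _ _ _ _ (phi^~ `|d|)) => [y _|]; first by rewrite E.
    apply: (@measurable_funS _ _ _ _ (@I01 R)) => //; first exact: atom_I01.
    exact: phi_measurable.
  transitivity (\int[mu]_(y in atom n k) (phi y `|d|)%:E)%E.
    by apply: eq_integral => y _; rewrite E.
  have p0 : 2 ^+ n != 0 :> R by rewrite expf_neq0// pnatr_eq0.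
  rewrite /= /average mulrA mulVf// mul1r /Rintegral fineK//.
  by apply: integrable_fin_num => //; exact: integrable_atom (phi_integrable _).
have [k2l k2r] := child_lt k2.
have giA := integrable_atom k2 gi.
set e := c n * ((average n.+1 k.*2 g - average n.+1 k.*2.+1 g) / 2).
have El y : atom n.+1 k.*2 y -> phi y `|d + \sum_(i < m.+1) c (n + i)%N *
      (condexp (n + i).+1 g y - condexp (n + i) g y)| =
   phi y `|(d + e) + \sum_(i < m) c (n.+1 + i)%N *
      (condexp (n.+1 + i).+1 g y - condexp (n.+1 + i) g y)|.
  move=> ky; have ky' : atom n k y by rewrite atom_split; left.
  rewrite big_ord_recl addn0 (condexp_atom _ ky) (condexp_atom _ ky') addrA.
  congr (phi _ `|_ + _ + _|).
    by rewrite /e (average_split giA); congr (_ * _); field.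
  by apply: eq_bigr => i _; rewrite lift0 addnS addSn.
have Er y : atom n.+1 k.*2.+1 y -> phi y `|d + \sum_(i < m.+1) c (n + i)%N *
      (condexp (n + i).+1 g y - condexp (n + i) g y)| =
   phi y `|(d - e) + \sum_(i < m) c (n.+1 + i)%N *
      (condexp (n.+1 + i).+1 g y - condexp (n.+1 + i) g y)|.
  move=> ky; have ky' : atom n k y by rewrite atom_split; right.
  rewrite big_ord_recl addn0 (condexp_atom _ ky) (condexp_atom _ ky') addrA.
  congr (phi _ `|_ + _ + _|).
    by rewrite /e (average_split giA); field.
  by apply: eq_bigr => i _; rewrite lift0 addnS addSn.
have [Il Ml] := IH n.+1 k.*2 (d + e) k2l.
have [Ir Mr] := IH n.+1 k.*2.+1 (d - e) k2r.
have M : measurable_fun (atom n k) (fun y => phi y `|d + \sum_(i < m.+1)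
    c (n + i)%N * (condexp (n + i).+1 g y - condexp (n + i) g y)|).
  rewrite atom_split; apply/(measurable_funU _ (mA _ _) (mA _ _)); split.
    by apply: eq_measurable_fun Ml => y /set_mem ky; rewrite El.
  by apply: eq_measurable_fun Mr => y /set_mem ky; rewrite Er.
split => //; rewrite atom_split ge0_integral_setU//; last first.
- exact: atom_disj.
- move=> y ky; rewrite lee_fin phi_ge0//.
  by apply: (atom_I01 k2); rewrite atom_split.
- by rewrite -atom_split; exact/measurable_EFinP.
set G := (fun y => (phi y _)%:E).
have I1 : (\int[mu]_(y in atom n.+1 k.*2) G y =
    (2 ^- n.+1 * tmod (d + e) (atom_tree c g m n.+1 k.*2))%:E)%E.
  by rewrite -Il; apply: eq_integral => y /set_mem ky; rewrite /G El.
have I2 : (\int[mu]_(y in atom n.+1 k.*2.+1) G y =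
    (2 ^- n.+1 * tmod (d - e) (atom_tree c g m n.+1 k.*2.+1))%:E)%E.
  by rewrite -Ir; apply: eq_integral => y /set_mem ky; rewrite /G Er.
rewrite [X in (X + _)%E]I1 [X in (_ + X)%E]I2 -EFinD; congr (_%:E).
have lgE m' n' k' : (k' < 2 ^ n')%N ->
    av (@lg R) (atom_tree c g m' n' k') = average n' k' g.
  exact: av_atom_tree.
rewrite /= !lgE// -/e exprS; field.
by rewrite expf_neq0// pnatr_eq0.
Qed.

(** * Measurable minorants and the passage from leaves to functions *)

Definition grid (n : nat) : R := Num.max 0 (ratr (odflt 0 (unpickle n)) : R).

Lemma grid_ge0 n : 0 <= grid n.
Proof. by rewrite /grid le_max lexx. Qed.

Lemma grid_dense (s t : R) : 0 <= s -> s < t -> exists n, s < grid n < t.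
Proof.
move=> s0 /rat_in_itvoo[r]; rewrite in_itv/= => /andP[sr rt].
exists (pickle r); rewrite /grid pickleK/= max_r ?sr//.
exact: le_trans s0 (ltW sr).
Qed.

(* [x |-> phi x (u x)] need not be measurable; its left-continuous minorant
   [sup {phi x r | r < u x}] is, and is comparable to it by doubling. *)
Lemma measurable_minorant u : measurable_fun (@I01 R) u -> (forall x, 0 <= u x) ->
  exists F : R -> R, [/\ measurable_fun (@I01 R) F, forall x, I01 x -> 0 <= F x,
    forall x, I01 x -> F x <= phi x (u x) &
    forall x, I01 x -> phi x (u x) <= C * 2 `^ p' * F x].
Proof.
move=> mu_ u0.
pose h n x := if grid n < u x then phi x (grid n) else 0.
have hu n x : I01 x -> h n x <= phi x (u x).
  move=> Ix; rewrite /h; case: ifP => gu; last exact: phi_ge0.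
  by rewrite phi_le ?grid_ge0// ltW.
pose F x := sups (h^~ x) 0.
have ubF x : I01 x -> has_ubound [set h k x | k in [set k | (0 <= k)%N]].
  by move=> Ix; exists (phi x (u x)) => _ [k _ <-]; exact: hu.
have hF n x : I01 x -> h n x <= F x.
  by move=> Ix; apply: ub_le_sup; [exact: ubF|exists n].
exists F; split.
- apply: measurable_fun_sups => [x Ix|n].
    by exists (phi x (u x)) => _ [k _ <-]; exact: hu.
  apply: measurable_fun_if => //.
  + exact: measurable_fun_ltr.
  + apply: (@measurable_funS _ _ _ _ (@I01 R)) => //.
    exact: phi_measurable (grid_ge0 n).
- move=> x Ix; apply: le_trans (hF 0%N x Ix).
  by rewrite /h; case: ifP => // _; rewrite phi_ge0// grid_ge0.
- move=> x Ix; apply: ge_sup => [|_ [k _ <-]]; last exact: hu.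
  by exists (h 0%N x), 0%N.
- move=> x Ix; have [_ _ _ H] := gphi Ix.
  have C0 : 0 <= C by exact: le_trans C1.
  have [ux0|ux0] := eqVneq (u x) 0.
    have [p0 _ _ _] := gphi Ix.
    rewrite ux0 p0 !mulr_ge0 ?powR_ge0//.
    apply: le_trans (hF 0%N x Ix).
    by rewrite /h; case: ifP => // _; rewrite phi_ge0// grid_ge0.
  have ux : 0 < u x by rewrite lt_neqAle eq_sym ux0 u0.
  have [n /andP[gn1 gn2]] := @grid_dense (u x / 2) (u x) ltac:(lra) ltac:(lra).
  apply: (@le_trans _ _ (phi x (2 * grid n))); first by apply: phi_le => //; lra.
  apply: le_trans (H _ _ _ (grid_ge0 n)) _; first by rewrite ler1n.
  rewrite ler_wpM2l ?mulr_ge0 ?powR_ge0//.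
  by apply: le_trans (hF n x Ix); rewrite /h gn2.
Qed.

(** A Jensen-type bound from A_q at the single level [a], the average of [u]. Where [u <= a / 2] at
    most half of [a] is collected; elsewhere [growth_below] applies. *)
Lemma average_phi_le : exists2 B : R, 0 < B &
  forall u F n k, (k < 2 ^ n)%N -> mu.-integrable (@I01 R) (EFin \o u) ->
    mu.-integrable (@I01 R) (EFin \o F) ->
    (forall x, 0 <= u x) -> (forall x, I01 x -> 0 <= F x) ->
    (forall x, I01 x -> phi x (u x) <= C * 2 `^ p' * F x) ->
    average n k (phi^~ (average n k u)) <= B * average n k F.
Proof.
have C0 : 0 < C by exact: lt_le_trans C1.
have K0 : 0 < K by exact: lt_le_trans K1.
(* Constant of [growth_below], then (a/u)^(p-q) <= 2^(p-q), then the price of replacing phi(x, u x)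
   by its minorant [F]. *)
pose c := C ^+ 2 * 2 `^ p' * 2 `^ (p - q) * (C * 2 `^ p').
have c0 : 0 < c by rewrite /c !mulr_gt0 ?exprn_gt0 ?powR_gt0.
have B0 : 0 < 4 `^ q * K * c.
  by apply: mulr_gt0 => //; apply: mulr_gt0 => //; exact: powR_gt0.
exists (4 `^ q * K * c) => //.
move=> u F n k k2 ui Fi u0 F0 uF.
set a := average n k u.
have a0 : 0 <= a by exact: average_ge0.
have AF0 : 0 <= average n k F.
  by apply: average_ge0 => x kx; apply: F0; exact: atom_I01 kx.
have [az|an] := eqVneq a 0.
  rewrite az; have [-> _ _ _] := average_growth k2.
  exact: mulr_ge0 (ltW B0) AF0.
have ap : 0 < a by rewrite lt_neqAle eq_sym an.
have aq : 0 < a `^ q by rewrite powR_gt0.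
have [si W] := Aqphi k2 ap.
have := @Aq_test R q K (average n k (dual_weight q a)) (average n k (phi^~ a))
  (a `^ q * c * average n k F) (a / 2) q1.
have S0 : 0 <= average n k (dual_weight q a).
  by apply: average_ge0 => x _; exact: powR_ge0.
have W0 : 0 <= average n k (phi^~ a).
  by apply: average_ge0 => x kx; apply: phi_ge0 (ltW ap); exact: atom_I01 kx.
have E0 : 0 <= a `^ q * c * average n k F.
  by apply: mulr_ge0 AF0; apply: ltW; exact: mulr_gt0.
move=> /(_ S0 W0 E0 W (divr_gt0 ap (ltr0n R 2))) T.
have {T} : (a / 2) `^ q * average n k (phi^~ a) <=
    2 `^ q * K * (a `^ q * c * average n k F).
  apply: T => l l0.
  have Fi' := integrable_atom k2 Fi.
  have -> : l * average n k (dual_weight q a) +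
      l `^ (1 - q) * (a `^ q * c * average n k F) =
    average n k (fun x => dual_weight q a x * l + F x * (l `^ (1 - q) * (a `^ q * c))).
    rewrite averageD; try exact: integrable_scale.
    by rewrite !averageZ//; ring.
  suff : a <= a / 2 + average n k (fun x => dual_weight q a x * l +
      F x * (l `^ (1 - q) * (a `^ q * c))) by lra.
  rewrite -(average_cst n k (a / 2)) -averageD; last 2 first.
  - exact: integrable_atom_cst.
  - by apply: integrable_add => //; exact: integrable_scale.
  apply: le_average.
  - exact: integrable_atom.
  - apply: integrable_add => //; first exact: integrable_atom_cst.
    by apply: integrable_add => //; exact: integrable_scale.
  move=> x kx; have Ix := atom_I01 k2 kx.
  have Fx := F0 x Ix.
  have lq : 0 <= l `^ (1 - q) by exact: powR_ge0.
  have sx : 0 <= dual_weight q a x * l by rewrite mulr_ge0 ?powR_ge0// ltW.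
  have Fx' : 0 <= F x * (l `^ (1 - q) * (a `^ q * c)).
    by apply: mulr_ge0 => //; apply: mulr_ge0 => //; apply: ltW; exact: mulr_gt0.
  have [ua|ua] := leP (u x) (a / 2); first lra.
  have up : 0 < u x by lra.
  have T1 := test_scale up l0 (fun b b0 => dual_weight_test q1 (phi_gt0 Ix ap) b0).
  have T2 := growth_below q (ltW C0) (ltW (lt_trans (lt_trans ltr01 q1) qp)) (gphi Ix) ap ua.
  have T3 : (a / u x) `^ (p - q) <= 2 `^ (p - q).
    rewrite ge0_ler_powR ?nnegrE ?divr_ge0 ?subr_ge0 ?(ltW qp) ?(ltW up)//.
    by rewrite ler_pdivrMr//; lra.
  have T4 : u x `^ q * phi x a <= a `^ q * c * F x.
    apply: le_trans T2 _.
    have -> : a `^ q * c * F x =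
      C ^+ 2 * 2 `^ p' * a `^ q * 2 `^ (p - q) * (C * 2 `^ p' * F x).
      by rewrite /c; ring.
    apply: ler_pM => //.
    - by rewrite !mulr_ge0 ?powR_ge0 ?exprn_ge0// ltW.
    - by rewrite phi_ge0.
    - by rewrite ler_wpM2l// !mulr_ge0 ?powR_ge0 ?exprn_ge0// ltW.
    - exact: uF.
  have T5 := ler_wpM2l lq T4.
  rewrite /dual_weight; lra.
rewrite powRM ?invr_ge0 ?(ltW ap)// -(powR_oppV _ (ltr0n R 2)) powRN.
have p2 : 0 < 2 `^ q :> R by rewrite powR_gt0.
have E4 : 4 `^ q = 2 `^ q * 2 `^ q :> R.
  by rewrite -powRM//; congr (_ `^ _); lra.
rewrite mulrAC ler_pdivrMr// => T.
rewrite -(ler_pM2l aq) E4; apply: le_trans T _.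
by rewrite le_eqVlt; apply/orP; left; apply/eqP; ring.
Qed.

(** * From the modular inequality to admissible constants *)

Lemma walsh_partial_sumZ n f (a : R) x : mu.-integrable (@I01 R) (EFin \o f) ->
  walsh_partial_sum n (fun y => f y * a) x = walsh_partial_sum n f x * a.
Proof.
move=> fi; rewrite /walsh_partial_sum mulr_suml; apply: eq_bigr => k _.
rewrite [RHS]mulrAC; congr (_ * _); rewrite /walsh_coef -RintegralZr//; last first.
  exact: integrable_walsh.
by apply: eq_Rintegral => y _; rewrite mulrAC.
Qed.

Lemma partial_sum_admissible : exists2 L : R, 0 < L & forall f n l,
  mu.-integrable (@I01 R) (EFin \o f) -> 0 < l ->
  (\int[mu]_(x in @I01 R) (phi x (`|f x| / l))%:E <= 1)%E ->
  (\int[mu]_(x in @I01 R) (phi x (`|walsh_partial_sum n f x| / (L * l)))%:E <= 1)%E.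
Proof.
have C0 : 0 < C by exact: lt_le_trans C1.
have [B [B0 HB]] := tree_bound p' q1 qp C1 K1.
have [B' B'0 HB'] := average_phi_le.
(* Dividing by [L] gains L^(-p) <= 1 / L from the lower type, which absorbs [B * C * B']; the 2
   keeps 1 / L below 1. *)
pose L := B * C * B' + 2.
have L0 : 2 <= L by rewrite lerDr !mulr_ge0 ?ltW.
exists L; first by lra.
move=> f n l fi l0 Hl.
pose u x := `|f x| * l^-1.
have ui : mu.-integrable (@I01 R) (EFin \o u).
  by apply: integrable_scale => //; exact: integrable_norm.
have u0 x : 0 <= u x by rewrite mulr_ge0// invr_ge0 ltW.
have mu_ : measurable_fun (@I01 R) u.
  by have /integrableP[/measurable_EFinP] := ui.
have [F [mF F0 Fle Fge]] := measurable_minorant mu_ u0.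
have IF : (\int[mu]_(x in @I01 R) (F x)%:E <= 1)%E.
  apply: le_trans Hl; apply: ge0_le_integral_lower => x Ix; rewrite lee_fin.
    exact: F0.
  exact: Fle.
have Fi : mu.-integrable (@I01 R) (EFin \o F).
  apply/integrableP; split; first exact/measurable_EFinP.
  apply: le_lt_trans (ltry 1); apply: le_trans IF.
  rewrite le_eqVlt; apply/orP; left; apply/eqP; apply: eq_integral => x /set_mem Ix /=.
  by rewrite ger0_norm// F0.
have F1 : average 0 0 F <= 1.
  rewrite /average expr0 mul1r -I01E -lee_fin /Rintegral fineK//.
  exact: integrable_fin_num.
pose a := (L * l)^-1.
have a0 : 0 < a by rewrite invr_gt0 mulr_gt0//; lra.
pose f' x := f x * a.
have fi' : mu.-integrable (@I01 R) (EFin \o f') by exact: integrable_scale.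
pose g x := f' x * walsh n x.
have gi : mu.-integrable (@I01 R) (EFin \o g) by exact: integrable_walsh.
pose c i : R := (bit n i)%:R.
have c1 i : `|c i| <= 1 by rewrite /c; case: bit; rewrite ?normr1 ?normr0.
(* Depth [n] covers all binary digits of [n], since n < 2^n. *)
pose t := atom_tree c g n 0 0.
have okt : tree_ok q p p' C K t by exact: atom_tree_ok.
have [It _] := @atom_tree_tmod c g n 0 0 0 gi isT.
have -> : (\int[mu]_(x in @I01 R)
    (phi x (`|walsh_partial_sum n f x| / (L * l)))%:E)%E = (tmod 0 t)%:E.
  rewrite expr0 invr1 mul1r in It; rewrite -[RHS]It -I01E.
  apply: eq_integral => x /set_mem Ix; congr (phi _ _)%:E.
  have -> : `|walsh_partial_sum n f x| / (L * l) = `|walsh_partial_sum n f' x|.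
    by rewrite walsh_partial_sumZ// normrM (gtr0_norm a0).
  rewrite (walsh_partial_sum_transform (ltn_expl n (isT : 1 < 2)%N) Ix fi') normrM walsh_norm.
  by rewrite mul1r add0r.
rewrite lee_fin; apply: le_trans (HB t okt) _.
have gE x : I01 x -> `|g x| = u x * L^-1.
  move=> Ix; rewrite /g /f' !normrM walsh_norm mulr1 (gtr0_norm a0) /u /a invfM.
  by ring.
have Li : 0 < L^-1 < 1 by rewrite invr_gt0 invf_lt1; lra.
have /andP[Li0 Li1] := Li.
have Lp : L^-1 `^ p <= L^-1.
  rewrite -[leRHS](powRr1 (ltW Li0)) ger_powR ?Li0 ?(ltW Li1)//.
  by have := q1; have := qp; lra.
have leafB i j : (j < 2 ^ i)%N ->
    lw (atom_leaf g i j) (lh (atom_leaf g i j)) <=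
    average i j (fun x => F x * (C * L^-1 * B')).
  move=> j2 /=; have Fi' := integrable_atom j2 Fi.
  rewrite averageZ//.
  have -> : average i j (fun x => `|g x|) = L^-1 * average i j u.
    rewrite mulrC -averageZ; last exact: integrable_atom.
    by apply: eq_average => x kx; apply: gE; exact: atom_I01 kx.
  have [_ _ H _] := average_growth j2.
  have au : 0 <= average i j u by exact: average_ge0.
  apply: le_trans (H _ _ Li au) _.
  have AF : 0 <= average i j F.
    by apply: average_ge0 => x kx; apply: F0; exact: atom_I01 kx.
  apply: (@le_trans _ _ (C * L^-1 * (B' * average i j F))); last first.
    by rewrite le_eqVlt; apply/orP; left; apply/eqP; ring.
  apply: ler_pM.
  - by rewrite mulr_ge0 ?powR_ge0// ltW.
  - apply: average_ge0 => x kx; apply: phi_ge0 => //; exact: atom_I01 kx.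
  - by rewrite ler_wpM2l// ltW.
  - exact: HB'.
have FiZ := integrable_scale (C * L^-1 * B') mI Fi.
have := @av_atom_tree_le (fun l => lw l (lh l)) _ c g n 0 0 leafB FiZ isT.
rewrite averageZ; last by rewrite -I01E.
move=> /(ler_wpM2l (ltW B0))/le_trans; apply.
have P0 : 0 <= B * C * B' by rewrite !mulr_ge0 ?ltW.
have -> : B * (average 0 0 F * (C * L^-1 * B')) = (B * C * B') * average 0 0 F / L.
  by ring.
rewrite ler_pdivrMr; last lra.
rewrite mul1r; apply: (@le_trans _ _ (B * C * B' * 1)); first exact: ler_wpM2l.
by rewrite mulr1 lerDl.
Qed.

End Assembly.

Theorem theorem6p1 (R : realType) (phi : R -> R -> R) (pminus pplus : R) :
  MO_function phi ->
  A_infty phi ->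
  unif_lower_type phi pminus ->
  unif_upper_type phi pplus ->
  q_index phi < pminus -> pminus <= pplus ->
  exists C : R, 0 < C /\
    forall f : R -> R, in_Lphi phi f -> in_L1 f ->
    forall n : nat,
      (Lphi_norm phi (walsh_partial_sum n f) <= C%:E * Lphi_norm phi f)%E.
Proof.
move=> mo Ainf [Cl [Cl0 Hl]] [Cu [Cu0 Hu]] qp _.
have [q [K [q1 qp' K1 HK]]] := q_index_lt mo Ainf qp.
pose C := Num.max 1 (Num.max Cl Cu).
have C1 : 1 <= C by rewrite le_max lexx.
have ClC : Cl <= C by rewrite !le_max lexx orbT.
have CuC : Cu <= C by rewrite !le_max lexx !orbT.
have gphi x : I01 x -> growth C pminus pplus (phi x).
  move=> Ix; have [wm w0 _ _] := mo; split.
  - exact: w0.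
  - by move=> s t; exact: wm.
  - move=> s t s01 t0; apply: le_trans (Hl x s t Ix s01 t0) _.
    by rewrite -!mulrA ler_wpM2r// mulr_ge0 ?powR_ge0// (phi_ge0 mo).
  - move=> s t s1 t0; apply: le_trans (Hu x s t Ix s1 t0) _.
    by rewrite -!mulrA ler_wpM2r// mulr_ge0 ?powR_ge0// (phi_ge0 mo).
have [L L0 HL] := partial_sum_admissible mo q1 qp' C1 K1 gphi HK.
exists L; split => // f _ fi n.
rewrite /Lphi_norm -ereal_inf_pZl//; apply/ereal_infP => _ [_ [l [l0 Il] <-] <-].
apply: ereal_inf_lbound; exists (L * l) => //; split; first exact: mulr_gt0.
exact: HL.
Qed.
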